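(* Let $\mathcal{G}$ be a $3$-regular planar lattice graph, invariant under the lattice $\Lambda\cong\mathbb{Z}^2$, such that $G=\mathcal{G}/\Lambda$ and its dual $G^*$ on the torus are $2$-connected, all their faces are topological disks, and each edge of $G$ intersects its dual edge exactly once and intersects no other edge of $G^*$. Let $\mathcal{G}'$ be the truncation of $\mathcal{G}$, i.e. the planar lattice graph obtained by replacing every vertex of $\mathcal{G}$ by a triangle while preserving each edge of $\mathcal{G}$. If $$\nu^{\lozenge}(\mathcal{G})\leq2\pi z_{\mathcal{G}}\leq\overline{\nu}(\mathcal{G}),$$ then $$\nu^{\lozenge}(\mathcal{G}')<2\pi z_{\mathcal{G}'}<\overline{\nu}(\mathcal{G}').$$
   Context: A planar lattice graph $\mathcal{G}$ is a connected locally finite planar graph embedded in $\mathbb{R}^2$ that is invariant under the translation action of a lattice $\Lambda\cong\mathbb{Z}^2$; $G=\mathcal{G}/\Lambda$ is the quotient graph on the torus $T^2=\mathbb{R}^2/\Lambda$, with vertex, edge and face sets $VG,EG,FG$, and $G^*$ is its dual graph on $T^2$. Truncation: each vertex $v$ of the $3$-regular graph $\mathcal{G}$ is replaced by a triangle (a complete graph $K_3$ bounding a face), whose three vertices are the new endpoints of the three edges of $\mathcal{G}$ at $v$, one each; $\mathcal{G}'$ is again $3$-regular and $\Lambda$-invariant. Spanning tree entropy: $z_{\mathcal{G}}=\lim_{n\to\infty}\frac{\log\tau(\Gamma_n)}{|V\Gamma_n|}$, where $\Gamma_n$ is the exhaustive nested sequence of finite connected planar graphs given by $n\times n$ copies of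 the $\Lambda$-fundamental domain of $\mathcal{G}$, $\tau$ is the number of spanning trees, and $V\Gamma_n$ is the vertex set. Bipyramid volume: Let $L(\theta)=-\int_0^\theta\log|2\sin t|\,dt$, and let $B_n$ ($n\ge 2$) be the hyperbolic regular ideal bipyramid over an $n$-gon, with $\mathrm{vol}(B_n)=2n\,L(\pi/n)$ (so $\mathrm{vol}(B_2)=0$). With $|f|$ the degree of a face $f$, $\mathrm{vol}^{\lozenge}(G)=\sum_{f\in FG}\mathrm{vol}(B_{|f|})$, and $\nu^{\lozenge}(\mathcal{G})=\frac{\mathrm{vol}^{\lozenge}(G)+\mathrm{vol}^{\lozenge}(G^* )}{|VG|}$. Upper quantity: $v_{\mathrm{oct}}=\mathrm{vol}(B_4)\approx 3.66386$ is the volume of the hyperbolic regular ideal octahedron, and $\overline{\nu}(\mathcal{G})=\frac{|EG|\,v_{\mathrm{oct}}}{|VG|}$. *)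

(* Defs.v *)
(* MathComp / MathComp-Analysis. *)
From HB Require Import structures.
From mathcomp Require Import all_boot all_order all_algebra all_fingroup.
From mathcomp Require Import finmap.
From mathcomp Require Import all_classical all_reals all_analysis.
Set Implicit Arguments.
Unset Strict Implicit.
Unset Printing Implicit Defensive.
Import Order.TTheory GRing.Theory Num.Theory.
Import numFieldNormedType.Exports.
Local Open Scope ring_scope.

(* An edge e is traversed in two directions: the dart (e, false) leaves one end
   of e and the dart (e, true) leaves the other.  Loops and parallel edges are
   allowed, and the types may be infinite. *)
Record multigraph := Multigraph {
  gvert : choiceType;
  gedge : choiceType;
  tail : gedge * bool -> gvert }.

Definition rev_dart (E : Type) (d : E * bool) : E * bool := (d.1, ~~ d.2).

Section Multigraphs.
Variable X : multigraph.
Local Notation V := (gvert X).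
Local Notation E := (gedge X).

Definition head (d : E * bool) : V := tail (rev_dart d).

Fixpoint walk (u : V) (p : seq (E * bool)) (v : V) : bool :=
  if p is d :: p' then (tail d == u) && walk (head d) p' v else u == v.

Definition joined (W : {pred V}) (T : {pred E}) (u v : V) : Prop :=
  exists p : seq (E * bool),
    [/\ walk u p v, all (fun d => d.1 \in T) p
      & all (fun d => (tail d \in W) && (head d \in W)) p].

Definition linked (W : {pred V}) (T : {pred E}) : Prop :=
  {in W &, forall u v, joined W T u v}.

Definition connected_graph : Prop := inhabited V /\ linked predT predT.

(* No vertex disconnects the graph when it is deleted. *)
Definition two_connected : Prop :=
  connected_graph /\ forall x : V, linked (predC1 x) predT.

(* Every cycle is empty; a loop is a cycle of length 1 and two parallel edges
   form a cycle of length 2. *)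
Definition acyclic (T : {pred E}) : Prop :=
  forall (u : V) (p : seq (E * bool)),
    walk u p u -> all (fun d => d.1 \in T) p ->
    uniq [seq d.1 | d <- p] -> uniq [seq tail d | d <- p] -> p = [::].

(* The remaining notions concern the subgraph induced by a finite set W of
   vertices. *)
Definition induced_edge (W : {fset V}) : {pred E} :=
  [pred e | (tail (e, false) \in W) && (tail (e, true) \in W)].

Definition spanning_tree (W : {fset V}) (T : {fset E}) : Prop :=
  [/\ {subset T <= induced_edge W}, linked (mem W) (mem T) & acyclic (mem T)].

(* [fset_set] is the enumeration of a finite set; the set below is finite as
   soon as X is locally finite. *)
Definition nb_spanning_trees (W : {fset V}) : nat :=
  #|` fset_set [set T : {fset E} | spanning_tree W T]%classic |.

End Multigraphs.

(* A graph with a cellular embedding (all faces are open disks) in a closed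
   oriented surface, as a combinatorial map: [rotation] sends a dart to the
   counterclockwise next one around its tail.  Vertices are the orbits of
   [rotation], and their degrees are the sizes of these orbits. *)
Record cmap := CMap {
  medge : finType;
  rotation : {perm medge * bool} }.

Section CombinatorialMaps.
Variable M : cmap.
Local Notation dart := (medge M * bool)%type.

Definition vertex : finType := {v : {set dart} | v \in porbits (rotation M)}.

Definition vertex_of (d : dart) : vertex :=
  exist _ (porbit (rotation M) d) (imset_f _ (erefl true)).

Lemma rev_dart_inj : injective (@rev_dart (medge M)).
Proof. by move=> [a b] [a' b'] [-> /(can_inj negbK) ->]. Qed.

(* The next dart along the boundary of a face: traverse d, then turn.  Faces
   are the orbits, and the size of an orbit is the degree of the face (an edge
   with the same face on both sides counts twice). *)
Definition face_perm : {perm dart} := (perm rev_dart_inj * rotation M)%g.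

Definition faces : {set {set dart}} := porbits face_perm.

Definition graph_of : multigraph :=
  @Multigraph vertex (medge M) vertex_of.

(* Euler characteristic 0. *)
Definition toroidal : Prop :=
  (#|{: vertex}| + #|faces| = #|{: medge M}|)%N.

Definition regular (k : nat) : Prop :=
  forall v : vertex, #|sval v| = k.

End CombinatorialMaps.

(* The dual map on the same surface.  An edge and its dual are the two readings
   of the same element of [medge M], so that each edge meets exactly one dual
   edge, its own, and meets it once.  The faces of the dual are the vertices of
   M, since rotation = face_perm of the dual. *)
Definition dual_map (M : cmap) : cmap := @CMap (medge M) (face_perm M).

(* A Z^2-invariant graph, given by its quotient G together with, for each edge
   e, the translation [edge_shift e] picked up along e: if the lift of e (directed
   as (e, false)) starts in cell x, then it ends in cell x + edge_shift e. *)
Record lattice_graph := LatticeGraph {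
  quotient_map :> cmap;
  edge_shift : medge quotient_map -> int * int }.

Section LatticeGraphs.
Variable G : lattice_graph.
Local Notation dart := (medge G * bool)%type.

Definition dart_shift (d : dart) : int * int :=
  if d.2 then - edge_shift d.1 else edge_shift d.1.

Definition cover_tail (d : (medge G * (int * int)) * bool) :
    vertex G * (int * int) :=
  let: (e, x, b) := d in
  (vertex_of (M := G) (e, b), if b then x + edge_shift e else x).

(* The lattice graph itself; the lattice acts by translation on the second
   component of vertices and edges. *)
Definition cover_graph : multigraph :=
  @Multigraph (vertex G * (int * int))%type (medge G * (int * int))%type
    cover_tail.

(* The quotient is cellularly embedded in the torus, and the surface carrying
   the cover is the plane: face boundaries lift to closed walks, and
   connectedness of the cover makes the induced map from the fundamental group
   Z^2 of the torus onto the lattice Z^2 surjective, hence bijective. *)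
Definition planar_lattice_graph : Prop :=
  [/\ connected_graph cover_graph, toroidal G
    & forall d : dart, \sum_(d' in porbit (face_perm G) d) dart_shift d' = 0].

(* A fundamental domain is given by a cell [c v] for each vertex v of the
   quotient, i.e. by one lift (v, c v) of each v.  The n x n translates of it
   are taken in a centred window, so that the sequence is nested and
   exhaustive. *)
Definition window (n : nat) (ij : 'I_n * 'I_n) : int * int :=
  (ij.1%:Z - (n./2)%:Z, ij.2%:Z - (n./2)%:Z).

Definition copies (c : vertex G -> int * int) (n : nat) : {fset gvert cover_graph} :=
  [fset ((w.1, (c w.1 + window w.2)%R) : gvert cover_graph)
    | w in {: vertex G * ('I_n * 'I_n)}]%fset.

Definition fundamental_domain (c : vertex G -> int * int) : Prop :=
  forall n : nat, (0 < n)%N ->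
    linked (mem (copies c n)) (induced_edge (copies c n)).

End LatticeGraphs.

(* Truncation.  The corners (new vertices) correspond to the darts of G.  The
   edges are the old edges [inl e] and, for each dart d, the side [inr d]
   joining the corner of d to the corner of the next dart [rotation G d].
   Counterclockwise around the corner of d one meets the old edge of d, the
   side [inr d] leaving forwards, and the side [inr (rotation^-1 d)] leaving
   backwards.  At a vertex of degree 3 the sides form a triangle. *)
Section Truncation.
Variable G : lattice_graph.
Local Notation dart := (medge G * bool)%type.
Local Notation tedge := (medge G + dart)%type.

Definition trunc_rot (d : tedge * bool) : tedge * bool :=
  match d with
  | (inl e, b) => (inr (e, b), false)
  | (inr d', false) => (inr ((rotation G)^-1%g d'), true)
  | (inr d', true) => let d := rotation G d' in (inl d.1, d.2)
  end.

Definition trunc_rot_inv (d : tedge * bool) : tedge * bool :=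
  match d with
  | (inl e, b) => (inr ((rotation G)^-1%g (e, b)), true)
  | (inr d', true) => (inr (rotation G d'), false)
  | (inr d', false) => (inl d'.1, d'.2)
  end.

Lemma trunc_rotK : cancel trunc_rot trunc_rot_inv.
Proof.
by move=> [[e|d] []] //=; rewrite ?permKV // -surjective_pairing permK.
Qed.

Definition trunc_shift (e : tedge) : int * int :=
  if e is inl e' then edge_shift e' else 0.

Definition truncation : lattice_graph :=
  @LatticeGraph (@CMap tedge (perm (can_inj trunc_rotK))) trunc_shift.

End Truncation.

Section Quantities.
Variable R : realType.

(* Used only for theta > 0; the integrand is singular (but integrable) at 0. *)
Definition lobachevsky (theta : R) : R :=
  - \int[lebesgue_measure]_(t in `[0, theta]%classic) ln `|2 * sin t|.

Definition vol_bipyramid (n : nat) : R :=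
  2 * n%:R * lobachevsky (pi / n%:R).

Definition vol_oct : R := vol_bipyramid 4.

Definition vol_lozenge (M : cmap) : R :=
  \sum_(f in faces M) vol_bipyramid #|f|.

Definition nu_lozenge (G : lattice_graph) : R :=
  (vol_lozenge G + vol_lozenge (dual_map G)) / #|{: vertex G}|%:R.

Definition nu_bar (G : lattice_graph) : R :=
  #|{: medge G}|%:R * vol_oct / #|{: vertex G}|%:R.

Definition spanning_tree_entropy (G : lattice_graph)
    (c : vertex G -> int * int) : R :=
  limn (fun n : nat =>
    ln (nb_spanning_trees (copies c n))%:R / #|` copies c n |%:R : R).

End Quantities.

(* Main.v *)
(* Let W be a finite connected piece of G with V vertices and E edges, and W' its
   truncation.  The triangles contribute 3 I - S S^T to the Laplacian of W',
   where S is the incidence matrix between corners and vertices; the old edges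
   form a matching, so their Laplacian M satisfies M^2 = 2 M, and S^T M S is the
   Laplacian of W.  Kirchhoff's theorem and det (I + A B) = det (I + B A) then
   give the exact formula
     tau(W') 3^(E+1) 5^V = tau(W) 5^(E+1) 9^V.
   Another choice of fundamental domain changes the pieces by O(n) edges, and k
   additional edges multiply the number of spanning trees of a connected graph
   with E edges by at most (2 (E + 1))^k.  As E = 3 V / 2 + O(n), the entropies
   satisfy z' = (z + (log 15) / 2) / 3.

   A face of degree k of G becomes a face of degree 2 k, and
   vol(B_2k) - vol(B_k) <= 2 pi log 2 by the duplication formula of the
   Lobachevsky function.  Since a cubic toroidal map has V / 2 faces, the two
   inequalities follow from 3 vol(B_3) < pi log (15/2) and
   pi log 15 < 3 v_oct. *)
Require Import Defs.
From mathcomp Require Import all_boot all_order all_algebra all_fingroup.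
From mathcomp Require Import zify ring lra.
Set Implicit Arguments.
Unset Strict Implicit.
Unset Printing Implicit Defensive.
Import Order.TTheory GRing.Theory Num.Theory.
Local Open Scope ring_scope.

(** * Spanning trees of finite graphs *)

(** Three choices shape the argument. Forests are treated as linearly independent rows of the
    incidence matrix, so extending a forest to a spanning tree and comparing a graph with a larger
    one become rank counts. In Kirchhoff's theorem the Laplacian is not cut down by a row and a
    column, which would not be compatible with passing from corners to vertices; it is perturbed by
    u u^T, with u the indicator of a root vertex downstairs and of its three corners upstairs.
    Finally, a piece cut out of the lattice has border vertices with missing edges, yet its
    truncation is given full triangles there. The determinant computation only sees that the corners
    are grouped in triangles and that the old edges form a matching, so the finite formula is exact
    without a border correction, and all errors come from changing the fundamental domain and
    counting edges. *)

Section Determinants.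
Variable R : comNzRingType.

(** Sylvester's identity: the two sides are the determinants of one pair of block matrices
    multiplied in the two possible orders. *)
Lemma det_add1_mulC m n (A : 'M[R]_(m, n)) (B : 'M[R]_(n, m)) :
  \det (1%:M + A *m B) = \det (1%:M + B *m A).
Proof.
have e1 : block_mx 1%:M A (- B) 1%:M *m block_mx 1%:M 0 B 1%:M
   = block_mx (1%:M + A *m B) A 0 1%:M.
  by rewrite mulmx_block !mulmx1 !mul1mx !mulmx0 !add0r addNr.
have e2 : block_mx 1%:M 0 B 1%:M *m block_mx 1%:M A (- B) 1%:M
   = block_mx 1%:M A 0 (1%:M + B *m A).
  by rewrite mulmx_block !mulmx1 !mul1mx !mul0mx !addr0 subrr addrC.
have := congr1 determinant e1; have := congr1 determinant e2.
by rewrite !det_mulmx !det_lblock !det_ublock !det1 !mulr1 !mul1r => <- <-.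
Qed.

Lemma det_add1_rank1 n (x : 'cV[R]_n) (y : 'rV[R]_n) :
  \det (1%:M + x *m y) = 1 + \sum_i y 0 i * x i 0.
Proof. by rewrite det_add1_mulC det_mx11 !mxE eqxx. Qed.

Lemma det_eq_row n (A : 'M[R]_n) (i j : 'I_n) :
  i != j -> (forall k, A i k = A j k) -> \det A = 0.
Proof. by move=> ij e; apply: (determinant_alternate ij). Qed.

(* Cauchy-Binet, summed over sequences of rows instead of sets of rows *)
Lemma det_gram_ffun (K : finType) n (g : K -> 'I_n -> R) :
  n`!%:R * \det (\matrix_(i, j) \sum_k g k i * g k j)
  = \sum_(f : {ffun 'I_n -> K}) (\det (\matrix_(i, j) g (f i) j)) ^+ 2.
Proof.
pose D (f : {ffun 'I_n -> K}) := \det (\matrix_(i, j) g (f i) j).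
have detE : \det (\matrix_(i, j) \sum_k g k i * g k j)
    = \sum_(f : {ffun 'I_n -> K}) (\prod_i g (f i) i) * D f.
  transitivity (\sum_(f : {ffun 'I_n -> K}) \sum_(s : 'S_n)
      (-1) ^+ s * \prod_i (g (f i) i * g (f i) (s i))).
    rewrite exchange_big; apply: eq_bigr => /= s _; rewrite -big_distrr /=.
    congr (_ * _).
    rewrite -(bigA_distr_bigA (fun i k => g k i * g k (s i))) /=.
    by apply: eq_bigr => x _; rewrite mxE.
  apply: eq_bigr => f _; rewrite /D /determinant big_distrr /=.
  apply: eq_bigr => s _; rewrite big_split /= mulrCA; congr (_ * (_ * _)).
  by apply: eq_bigr => i _; rewrite mxE.
pose fp (s : 'S_n) (f : {ffun 'I_n -> K}) : {ffun 'I_n -> K} := [ffun i => f (s i)].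
have detp s f : D (fp s f) = (-1) ^+ s * D f.
  rewrite /D -det_perm -det_mulmx; congr (\det _).
  by rewrite -row_permE; apply/matrixP => i j; rewrite !mxE ffunE.
(* Reindexing by a permutation s of the rows moves its sign onto the monomial. Adding the n!
   expressions so obtained assembles the monomials into a second determinant. *)
have sumE (s : 'S_n) : \det (\matrix_(i, j) \sum_k g k i * g k j)
   = \sum_(f : {ffun 'I_n -> K}) ((-1) ^+ s * \prod_i g (f (s i)) i) * D f.
  rewrite detE (reindex (fp s)) /=; last first.
    exists (fp s^-1%g) => f _; apply/ffunP => i;
    by rewrite !ffunE ?permK ?permKV.
  apply: eq_bigr => f _; rewrite detp mulrCA mulrA; congr (_ * _ * _).
  by apply: eq_bigr => i _; rewrite ffunE.
rewrite -(card_Sn n) mulr_natl -sumr_const.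
under eq_bigr => s _ do rewrite (sumE s).
rewrite exchange_big /=.
apply: eq_bigr => f _; rewrite -big_distrl /= expr2 -/(D f); congr (_ * _).
rewrite /D -det_tr /determinant; apply: eq_big => [s|s _]; first by rewrite !inE.
by congr (_ * _); apply: eq_bigr => i _; rewrite !mxE.
Qed.
End Determinants.

Lemma card_inj_ffun_imset (n : nat) (K : finType) (S : {set K}) : #|S| = n ->
  #|[set f : {ffun 'I_n -> K} | injectiveb f && (f @: setT == S)]| = n`!.
Proof.
move=> cS; have -> : n`! = (#|S| ^_ #|'I_n|)%N by rewrite cS card_ord ffactnn.
rewrite -(card_inj_ffuns_on _ (mem S)).
apply: eq_card => f; rewrite !inE andbC;
case: (boolP (injectiveb f)) => [/injectiveP fi|]; rewrite ?andbF ?andbT //.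
apply/eqP/ffun_onP => [<- i|fS]; first exact: imset_f.
apply/eqP; rewrite eqEcard (card_imset _ fi) cardsT card_ord cS leqnn andbT.
by apply/subsetP => _ /imsetP[i _ ->].
Qed.

(** A choice of rows that is not injective repeats a row and contributes 0, and each set of n rows
    is the image of n! injective choices, which cancels the factor in [det_gram_ffun]. *)
Lemma det_gram_sets (K : finType) n (g : K -> 'I_n -> int) (c : {set K} -> int) :
  (forall f : {ffun 'I_n -> K}, injective f ->
    (\det (\matrix_(i, j) g (f i) j)) ^+ 2 = c (f @: setT)) ->
  \det (\matrix_(i, j) \sum_k g k i * g k j) = \sum_(S : {set K} | #|S| == n) c S.
Proof.
move=> H; have n0 : (n`!%:R : int) != 0 by rewrite pnatr_eq0 -lt0n fact_gt0.
apply: (mulfI n0); rewrite det_gram_ffun.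
rewrite (bigID (fun f : {ffun 'I_n -> K} => injectiveb f)) /= [X in _ + X]big1 ?addr0; last first.
  move=> f /injectivePn[i [j ij fij]].
  by rewrite (@det_eq_row _ _ _ i j) ?expr0n // => k; rewrite !mxE fij.
rewrite (partition_big (fun f : {ffun 'I_n -> K} => f @: setT) (fun S => #|S| == n)) /=; last first.
  by move=> f /injectiveP fi; rewrite (card_imset _ fi) cardsT card_ord.
rewrite big_distrr /=; apply: eq_bigr => S /eqP cS.
rewrite (eq_bigr (fun=> c S)) => [|f /andP[/injectiveP fi /eqP <-]]; last exact: H.
rewrite -(card_inj_ffun_imset cS) mulr_natl -sumr_const.
by apply: eq_bigl => f; rewrite inE.
Qed.

Lemma det_eq0_mulcol n (A : 'M[int]_n) (w : 'cV[int]_n) :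
  w != 0 -> A *m w = 0 -> \det A = 0.
Proof.
move=> w0 Aw; apply/eqP/negP => /negP dA; case/negP: w0; apply/eqP.
have : \adj A *m (A *m w) = 0 by rewrite Aw mulmx0.
rewrite mulmxA mul_adj_mx mul_scalar_mx => /matrixP e; apply/matrixP => i j.
have := e i j; rewrite !mxE => /eqP; rewrite mulf_eq0 (negbTE dA) /= => /eqP -> //.
Qed.
Lemma big_option (R : nmodType) (E : finType) (F : option E -> R) :
  \sum_k F k = F None + \sum_e F (Some e).
Proof.
rewrite (bigD1 None) //=; congr (_ + _).
rewrite (reindex_omap Some id) /=; last by case.
by apply: eq_bigl => e; rewrite eqxx.
Qed.

Section FiniteGraph.
Variables (V E : finType) (s t : E -> V).
Implicit Types (T : {set E}) (u v w : V).

Definition adj_by T : rel V :=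
  [rel u v | [exists e in T, (u == s e) && (v == t e) || (u == t e) && (v == s e)]].

Definition connected_by T : bool := [forall u, forall v, connect (adj_by T) u v].

(** The edge count replaces acyclicity, since it is what selects a square minor in Cauchy-Binet;
    [nb_spanning_treesE] identifies the result with [spanning_tree]. *)
Definition trees : {set {set E}} :=
  [set T : {set E} | connected_by T & #|T|.+1 == #|V|].

Definition incidence (R : pzRingType) (e : E) (v : V) : R :=
  (s e == v)%:R - (t e == v)%:R.

Lemma connected_byP T : reflect (forall u v, connect (adj_by T) u v) (connected_by T).
Proof. by apply: (iffP forallP) => H u; apply/forallP. Qed.

Lemma adj_by_sym T u v : adj_by T u v = adj_by T v u.
Proof.
by apply: eq_existsb => e /=; congr (_ && _); rewrite orbC andbC [X in _ || X]andbC.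
Qed.

Lemma connect_by_sym T : connect_sym (adj_by T).
Proof. exact/sym_connect_sym/adj_by_sym. Qed.

Lemma adj_by_edge T e : e \in T -> adj_by T (s e) (t e).
Proof. by move=> eT; apply/exists_inP; exists e; rewrite ?eqxx. Qed.

Lemma connect_edge T e v : e \in T ->
  connect (adj_by T) v (s e) = connect (adj_by T) v (t e).
Proof.
by move=> eT; have /= -> := same_connect_r (@connect_by_sym T) (connect1 (adj_by_edge eT)) v.
Qed.

Lemma sum_incidence (R : pzRingType) (f : V -> R) e :
  \sum_v incidence R e v * f v = f (s e) - f (t e).
Proof.
under eq_bigr do rewrite mulrBl.
have pick x : \sum_v (x == v)%:R * f v = f x.
  rewrite (bigD1 x) //= eqxx mul1r big1 ?addr0 // => v /negbTE nv.
  by rewrite eq_sym nv mul0r.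
by rewrite sumrB !pick.
Qed.

(** Each edge of a path from r to v gets a sign according to the direction in which it is traversed,
    and the boundary telescopes. *)
Lemma connect_coeff T r v : connect (adj_by T) r v ->
  exists a : {ffun E -> int}, (forall e, e \notin T -> a e = 0) /\
    forall w, \sum_(e in T) a e * incidence int e w = (v == w)%:R - (r == w)%:R.
Proof.
move=> /connectP[p]; elim/last_ind: p v => [|p x IH] v /=.
  move=> _ ->; exists [ffun=> 0]; split=> [e|w]; rewrite ?ffunE //.
  by rewrite big1 ?subrr // => e; rewrite ffunE mul0r.
rewrite rcons_path last_rcons => /andP[pth /exists_inP[e eT xe]] ->.
have [a [a0 aE]] := IH _ pth erefl.
(* The row of e is positive at [s e], so traversing e from [s e] to [t e] counts -1. *)
pose b : int := if (last r p == s e) && (x == t e) then -1 else 1.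
exists [ffun e' => a e' + (if e' == e then b else 0)]; split=> [e' e'T|w].
  by rewrite ffunE a0 // add0r ifF //; apply: contraNF e'T => /eqP->.
under eq_bigr do rewrite ffunE mulrDl.
rewrite big_split /= aE [X in _ + X](bigD1 e) //= [X in _ + (_ + X)]big1 ?addr0; last first.
  by move=> e' /andP[_ /negbTE->]; rewrite mul0r.
rewrite eqxx /b /incidence; case: ifP => [/andP[/eqP-> /eqP->]|H]; first by ring.
by move: xe; rewrite H /= => /andP[/eqP-> /eqP->]; ring.
Qed.

(** With u as an extra row indexed by [None], the matrix is a Gram matrix and Cauchy-Binet applies:
    a set of rows contributes only if it consists of [None] and the edges of a spanning tree, and
    then its squared minor is the square of the sum of u. *)
Lemma kirchhoff (u : V -> int) (n := #|V|) : (0 < n)%N ->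
  \det (\matrix_(i < n, j < n)
     ((\sum_e incidence int e (enum_val i) * incidence int e (enum_val j))
       + u (enum_val i) * u (enum_val j)))
  = (\sum_v u v) ^+ 2 * #|trees|%:R.
Proof.
move=> n0; have /card_gt0P[r _] := n0; pose sg := \sum_v u v.
pose g (k : option E) (i : 'I_n) : int :=
  if k is Some e then incidence int e (enum_val i) else u (enum_val i).
pose c (S : {set option E}) : int :=
  if (None \in S) && connected_by (Some @^-1: S) then sg ^+ 2 else 0.
have gram f : injective f -> (\det (\matrix_(i, j) g (f i) j)) ^+ 2 = c (f @: setT); last first.
  transitivity (\det (\matrix_(i, j) \sum_k g k i * g k j)).
    congr (\det _); apply/matrixP => i j; rewrite !mxE big_option /= addrC.
    done.
  rewrite (det_gram_sets gram) /c -big_mkcondr /= sumr_const mulr_natr; congr (_ *+ _).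
  have nN (T : {set E}) : None \notin Some @: T by apply/negP => /imsetP[].
  pose ext T : {set option E} := None |: (Some @: T).
  have ext_inj : injective ext.
    move=> T1 T2 /setP eT; apply/setP => e; have := eT (Some e).
    by rewrite !inE /= !mem_imset //; apply: Some_inj.
  have preext T : Some @^-1: ext T = T.
    by apply/setP => e; rewrite !inE /= mem_imset //; apply: Some_inj.
  rewrite -(card_imset _ ext_inj); apply: eq_card => S; apply/idP/imsetP.
    rewrite unfold_in => /and3P[/eqP cS NS co].
    have eS : S = ext (Some @^-1: S).
      apply/setP => -[e|]; last by rewrite NS !inE.
      by rewrite !inE /= mem_imset ?inE //; apply: Some_inj.
    exists (Some @^-1: S) => //; rewrite inE co /=.
    move: cS; rewrite {1}eS cardsU1 card_imset; last exact: Some_inj.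
    by rewrite nN add1n => ->.
 case=> T Ttree ->; move: Ttree; rewrite inE => /andP[co cT]; rewrite unfold_in preext co setU11 andbT.
  rewrite cardsU1 card_imset; last exact: Some_inj.
  by rewrite nN add1n cT.
move=> fi; rewrite /c; set S := f @: setT; set T := Some @^-1: S.
have fS i : f i \in S by apply: imset_f.
case: (boolP (None \in S)) => /= [NS|NS]; last first.
  (* Only edge rows are present, and they all annihilate constant vectors. *)
  rewrite (@det_eq0_mulcol _ _ (const_mx 1)) ?expr0n //.
    by apply/eqP => /matrixP /(_ (Ordinal n0) 0); rewrite !mxE.
  apply/matrixP => i j; rewrite !mxE.
  case fE: (f i) (fS i) => [e|] fSi; last by rewrite fSi in NS.
  under eq_bigr do rewrite !mxE fE /=.
  rewrite -(big_enum_val (fun v => incidence int e v * 1)) /= (sum_incidence (fun=> 1)).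
  by rewrite subrr.
case: ifP => [/connected_byP co|/negbT]; last first.
  move=> /forallPn[a /forallPn[b nab]].
  pose C v := connect (adj_by T) a v.
  have Ca : C a by apply: connect0.
  have Cb : C b = false by apply: negbTE.
  pose uC := \sum_v u v * (C v)%:R; pose uD := \sum_v u v * (~~ C v)%:R.
  (* A vector constant on C and on its complement is killed by the edge rows. The two values are
     chosen so that [al * uC + be * uD = 0], which kills the row u as well; if both sums vanish, the
     indicator of C does it. *)
  pose al : int := if (uC == 0) && (uD == 0) then 1 else uD.
  pose be : int := if (uC == 0) && (uD == 0) then 0 else - uC.
  pose wt v : int := if C v then al else be.
  have wtE v : wt v = (C v)%:R * al + (~~ C v)%:R * be.
    by rewrite /wt; case: (C v); rewrite /= ?mul1r ?mul0r ?addr0 ?add0r.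
  rewrite (@det_eq0_mulcol _ _ (\col_i wt (enum_val i))) ?expr0n //.
    apply/eqP => /matrixP H.
    have := H (enum_rank a) 0; have := H (enum_rank b) 0.
    rewrite !mxE !enum_rankK /wt Ca Cb /al /be; case: ifP => // /negP nz.
    move=> /eqP; rewrite oppr_eq0 => uC0 uD0; apply: nz; by rewrite uC0 uD0 eqxx.
  apply/matrixP => i j; rewrite !mxE.
  case fE: (f i) (fS i) => [e|] fSi.
    under eq_bigr do rewrite !mxE fE /=.
    rewrite -(big_enum_val (fun v => incidence int e v * wt v)) /= sum_incidence.
    by rewrite /wt /C (@connect_edge T e) ?subrr // inE.
  under eq_bigr do rewrite !mxE fE /=.
  rewrite -(big_enum_val (fun v => u v * wt v)) /=.
  under eq_bigr do rewrite wtE mulrDr !mulrA.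
  rewrite big_split /= -!big_distrl /= -/uC -/uD /al /be.
  by case: ifP => [/andP[/eqP-> /eqP->]|_]; ring.
have [a aP] := fin_all_exists (fun v => connect_coeff (co r v)).
(* Row i lists the coefficients of a path from r to the vertex i, with 1 in the column of [None].
   For u' the indicator of r the product in [AB] is the identity, so [\det A] is a unit of the
   integers, hence 1 or -1; for u itself it is a rank-one perturbation of the identity whose
   determinant is the sum of u. *)
pose A : 'M[int]_n := \matrix_(i, j) if f j is Some e then a (enum_val i) e else 1.
pose gu (u' : V -> int) (k : option E) (i : 'I_n) : int :=
  if k is Some e then incidence int e (enum_val i) else u' (enum_val i).
have AB (u' : V -> int) : A *m (\matrix_(i, j) gu u' (f i) j) =
   1%:M + (\col_(i < n) 1) *m (\row_(j < n) (u' (enum_val j) - (r == enum_val j)%:R)).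
  apply/matrixP => i l; rewrite !mxE big_ord1 !mxE mul1r.
  under eq_bigr do rewrite !mxE.
  pose F (k : option E) := (if k is Some e then a (enum_val i) e else 1) * gu u' k l.
  transitivity (\sum_(k in S) F k).
    by rewrite big_imset /=; [apply: eq_bigl => k; rewrite !inE|move=> x y _ _; apply: fi].
  rewrite (bigID (pred1 None)) /= (big_pred1 None); last first.
    by move=> k /=; rewrite andbC; case: eqP => //= ->; rewrite NS.
  rewrite big_mkcond big_option /= andbF add0r -big_mkcond /= {1}/F mul1r addrC.
  have [_ aE] := aP (enum_val i).
  transitivity (\sum_(e in T) a (enum_val i) e * incidence int e (enum_val l) + u' (enum_val l)).
    by congr (_ + _); apply: eq_bigl => e; rewrite !inE andbT.
  rewrite aE (inj_eq enum_val_inj); ring.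
have dA : \det A ^+ 2 = 1.
  have /(congr1 determinant) := AB (fun v => (r == v)%:R).
  rewrite det_mulmx (_ : \row__ _ = 0) ?mulmx0 ?addr0 ?det1; last first.
    by apply/matrixP => x y; rewrite !mxE subrr.
  move=> dAB; have : \det A \is a GRing.unit by apply/unitrPr; eexists; exact: dAB.
  by move/orP=> []/eqP->; rewrite ?expr1n ?sqrrN ?expr1n.
have /(congr1 determinant) := AB u.
rewrite det_mulmx det_add1_rank1 => dAB.
transitivity ((\det A * \det (\matrix_(i, j) gu u (f i) j)) ^+ 2).
  by rewrite exprMn dA mul1r.
rewrite dAB; congr (_ ^+ 2).
under eq_bigr do rewrite !mxE mulr1.
rewrite -(big_enum_val (fun v => u v - (r == v)%:R)) sumrB.
have -> : \sum_v (r == v)%:R = 1 :> int.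
  rewrite (bigD1 r) //= eqxx big1 ?addr0 // => v vr.
  by rewrite eq_sym (negbTE vr).
by rewrite addrC subrK.
Qed.
End FiniteGraph.

(** * Truncation of finite graphs *)

(** Entries are rational because a matrix gets inverted in [trees_truncation]. *)
Definition finmx (A B : finType) (f : A -> B -> rat) : 'M[rat]_(#|A|, #|B|) :=
  \matrix_(i, j) f (enum_val i) (enum_val j).

Lemma eq_finmx (A B : finType) (f g : A -> B -> rat) :
  (forall a b, f a b = g a b) -> finmx f = finmx g.
Proof. by move=> fg; apply/matrixP => i j; rewrite !mxE. Qed.

Lemma mul_finmx (A B C : finType) (f : A -> B -> rat) (g : B -> C -> rat) :
  finmx f *m finmx g = finmx (fun a c => \sum_b f a b * g b c).
Proof.
apply/matrixP => i j; rewrite !mxE; under eq_bigr do rewrite !mxE.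
by rewrite -(big_enum_val (fun b => f (enum_val i) b * g b (enum_val j))).
Qed.

Lemma tr_finmx (A B : finType) (f : A -> B -> rat) :
  (finmx f)^T = finmx (fun b a => f a b).
Proof. by apply/matrixP => i j; rewrite !mxE. Qed.

Lemma finmx1 (A : finType) : 1%:M = finmx (fun a b : A => (a == b)%:R).
Proof. by apply/matrixP => i j; rewrite !mxE (inj_eq enum_val_inj). Qed.

Lemma kirchhoff_rat (V E : finType) (s t : E -> V) (u : V -> int) : (0 < #|V|)%N ->
  \det (finmx (fun v w => \sum_e incidence s t rat e v * incidence s t rat e w
     + (u v)%:~R * (u w)%:~R))
  = (\sum_v u v)%:~R ^+ 2 * #|trees s t|%:R.
Proof.
move=> V0; have /(congr1 (fun x : int => x%:~R : rat)) := @kirchhoff V E s t u V0.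
rewrite rmorphM rmorphXn /= rmorph_nat => <-.
rewrite -det_map_mx; congr (\det _); apply/matrixP => i j; rewrite !mxE.
rewrite rmorphD rmorph_sum rmorphM /=; congr (_ + _); apply: eq_bigr => e _.
by rewrite rmorphM /incidence !rmorphB /= !rmorph_nat.
Qed.

Section Truncation.
Variables (V E C : finType) (s t : E -> V) (p : C -> V) (rho : C -> C).
Variables (sg ta : E -> C).
Hypothesis psg : forall e, p (sg e) = s e.
Hypothesis pta : forall e, p (ta e) = t e.
Hypothesis sg_inj : injective sg.
Hypothesis ta_inj : injective ta.
Hypothesis sg_ta : forall e f, sg e != ta f.
Hypothesis rho_inj : injective rho.
Hypothesis p_surj : forall v, exists a, p a = v.
(** An equation between numbers says at once that the three cases cover a fibre and exclude one
    another, so that the fibres are 3-cycles of rho. It is also the entrywise form of: the Laplacian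
    of the triangles is 3 I - S S^T. *)
Hypothesis fiber : forall a b,
  (p a == p b : nat) = ((a == b) + (rho a == b) + (rho b == a))%N.

Definition trunc_src (e : E + C) : C := match e with inl e => sg e | inr a => a end.
Definition trunc_dst (e : E + C) : C := match e with inl e => ta e | inr a => rho a end.

Lemma sum_eq_op (A : finType) (f : A -> rat) x : \sum_a (x == a)%:R * f a = f x.
Proof.
rewrite (bigD1 x) //= eqxx mul1r big1 ?addr0 // => v vx.
by rewrite eq_sym (negbTE vx) mul0r.
Qed.

Lemma sum_eq1 (A : finType) (x : A) : \sum_a (x == a)%:R = 1 :> rat.
Proof.
by rewrite -[RHS](sum_eq_op (fun=> 1) x); apply: eq_bigr => a _; rewrite mulr1.
Qed.

Lemma fiberR a b : (p a == p b)%:R = (a == b)%:R + (rho a == b)%:R + (rho b == a)%:R :> rat.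
Proof. by rewrite fiber !natrD. Qed.

Lemma sum_rho (f : C -> rat) a : \sum_x (rho x == a)%:R * f (rho x) = f a.
Proof.
rewrite -[RHS](sum_eq_op f) [RHS](reindex rho) /=; last exact/onW_bij/injF_bij.
by apply: eq_bigr => x _; rewrite eq_sym.
Qed.

Lemma fiber_card v : \sum_a (p a == v)%:R = 3 :> rat.
Proof.
have [a <-] := p_surj v.
under eq_bigr do rewrite eq_sym fiberR.
have e : \sum_x (rho x == a)%:R = 1 :> rat.
  by rewrite -[RHS](sum_rho (fun=> 1) a); apply: eq_bigr => x _; rewrite mulr1.
by rewrite !big_split /= !sum_eq1 e.
Qed.

Lemma card_trunc_vertices : #|C| = (3 * #|V|)%N.
Proof.
apply/eqP; rewrite -(eqr_nat rat) natrM -!sum1_card !natr_sum; apply/eqP.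
transitivity (\sum_(v : V) \sum_a (p a == v)%:R : rat).
  by rewrite exchange_big /=; apply: eq_bigr => a _; rewrite sum_eq1.
by rewrite big_distrr; apply: eq_bigr => v _; rewrite fiber_card /= mulr1n mulr1.
Qed.

Let B := finmx (incidence sg ta rat).
Let S := finmx (fun a v => (p a == v)%:R).
Let D := finmx (incidence s t rat).

Let BBt : B *m B^T = 2%:M.
Proof.
rewrite tr_finmx mul_finmx -[2%:M]mulmx1 mul_scalar_mx finmx1.
apply/matrixP => i j; rewrite !mxE (sum_incidence sg ta (incidence sg ta rat (enum_val j))).
rewrite /incidence !(inj_eq sg_inj) !(inj_eq ta_inj) !(negbTE (sg_ta _ _)).
rewrite !(eq_sym (ta _) (sg _)) !(negbTE (sg_ta _ _)) (eq_sym (enum_val j)).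
by rewrite mulr0n; ring.
Qed.

Let StS : S^T *m S = 3%:M.
Proof.
rewrite tr_finmx mul_finmx -[3%:M]mulmx1 mul_scalar_mx finmx1.
apply/matrixP => i j; rewrite !mxE.
rewrite -(fiber_card (enum_val i)) big_distrl /=; apply: eq_bigr => a _.
by case: eqP => [->|]; rewrite ?mul0r.
Qed.

Let BS : B *m S = D.
Proof.
rewrite mul_finmx; apply: eq_finmx => e v.
by rewrite (sum_incidence sg ta (fun a => (p a == v)%:R)) psg pta.
Qed.

Let lapE : finmx (fun a b => \sum_e incidence trunc_src trunc_dst rat e a
     * incidence trunc_src trunc_dst rat e b) = B^T *m B + 3%:M - S *m S^T.
Proof.
rewrite !tr_finmx !mul_finmx -[3%:M]mulmx1 mul_scalar_mx finmx1.
apply/matrixP => i j; rewrite !mxE big_sumType /= -!addrA; congr (_ + _).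
set a := enum_val i; set b := enum_val j.
rewrite (eq_bigr (fun v => (p a == v)%:R * (p b == v)%:R)) // sum_eq_op eq_sym fiberR.
rewrite /incidence /=.
rewrite (eq_bigr (fun x => (a == x)%:R * (x == b)%:R - (a == x)%:R * (rho x == b)%:R
   - (b == x)%:R * (rho x == a)%:R + (rho x == a)%:R * (rho x == b)%:R)); last first.
  by move=> x _; rewrite (eq_sym x a) (eq_sym x b); ring.
rewrite big_split /= !sumrB !sum_eq_op.
rewrite [X in _ + X](_ : _ = (a == b)%:R); first by rewrite (eq_sym b a); ring.
by rewrite (sum_rho (fun x => (x == b)%:R)).
Qed.

Lemma trees_truncation :
  (0 < #|V|)%N ->
  (#|trees trunc_src trunc_dst| * (3 ^ #|E|.+1 * 5 ^ #|V|)
    = #|trees s t| * (5 ^ #|E|.+1 * 9 ^ #|V|))%N.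
Proof.
move=> V0; have /card_gt0P[r _] := V0.
have C0 : (0 < #|C|)%N by rewrite card_trunc_vertices muln_gt0.
pose c : rat := 15%:R^-1; pose ev := finmx (fun (v : V) (_ : unit) => (v == r)%:R).
pose X := B^T *m B; pose L := D^T *m D.
have XX : X *m X = 2%:R *: X.
  by rewrite /X mulmxA -[B^T *m B *m _]mulmxA BBt mul_mx_scalar -scalemxAl.
(* X^2 = 2 X makes the inverse of N affine in X. Then S^T Ni S = (3 - L / 5) / 3 = 1 - L / 15, the
   origin of c. *)
pose N := X + 3%:M; pose Ni := 3%:R^-1 *: (1%:M - 5%:R^-1 *: X).
have NNi : N *m Ni = 1%:M.
  rewrite /N /Ni -scalemxAr mulmxBr mulmx1 -scalemxAr mulmxDl XX mul_scalar_mx.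
  rewrite -scalerDl scalerA scalerBr scalerDr scalerA scale_scalar_mx.
  rewrite addrAC -scalerBl (_ : _ - _ = 0) ?scale0r ?add0r; last by field.
  by congr (_ %:M); field.
have detN : \det N = 3%:R ^+ #|C| * (5%:R / 3%:R) ^+ #|E|.
  have -> : N = 3%:R *: (1%:M + (3%:R^-1 *: B^T) *m B).
    rewrite scalerDr -scalemxAl scalerA divff // scale1r scale_scalar_mx mulr1.
    by rewrite addrC.
  rewrite detZ det_add1_mulC -scalemxAr BBt scale_scalar_mx -raddfD /= det_scalar.
  by congr (_ * _ ^+ _); field.
have StNiS : S^T *m (Ni *m S) = 1%:M - c *: L.
  rewrite /Ni -scalemxAl mulmxBl mul1mx -scalemxAl -scalemxAr mulmxBr StS -scalemxAr.
  have -> : S^T *m (X *m S) = L.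
    by rewrite /X /L -BS trmx_mul !mulmxA.
  rewrite scalerBr scale_scalar_mx scalerA; congr (_%:M - _ *: _).
have ete : ev^T *m ev = 1%:M.
  rewrite tr_finmx mul_finmx finmx1; apply: eq_finmx => -[] [] /=.
  by rewrite -[RHS](sum_eq1 r); apply: eq_bigr => v _; rewrite (eq_sym r); case: eqP; rewrite ?mulr1 ?mulr0.
pose one := finmx (fun (_ : unit) (v : V) => 1).
have oneL : one *m L = 0.
  have -> : L = (D^T *m D)^T by rewrite trmx_mul trmxK.
  rewrite trmx_mul trmxK mulmxA (_ : one *m D^T = 0) ?mul0mx //.
  rewrite tr_finmx mul_finmx; apply/matrixP => i j; rewrite !mxE.
  under eq_bigr do rewrite mulrC.
  by rewrite (sum_incidence s t (fun=> 1)) subrr.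
have onee : one *m ev = 1%:M.
  rewrite mul_finmx finmx1; apply: eq_finmx => -[] [].
  by rewrite -[RHS](sum_eq1 r); apply: eq_bigr => v _; rewrite mul1r eq_sym.
(* Er grounds the Laplacian of the graph at r; pulled back along S, it grounds
   the Laplacian of the truncation at the three corners of r together. *)
pose Er := ev *m ev^T.
have ErEr : Er *m Er = Er by rewrite /Er mulmxA -[ev *m _ *m ev]mulmxA ete mulmx1.
have rank1 (x : 'M[rat]_(#|V|, #|{: unit}|)) (y : 'M[rat]_(#|{: unit}|, #|V|)) :
    \det (1%:M + x *m y) = \det (1%:M + y *m x) := det_add1_mulC x y.
have cu : #|{: unit}| = 1%N by rewrite card_unit.
have tauV : \det (L + Er) = #|trees s t|%:R.
  have := @kirchhoff_rat _ _ s t (fun v => (v == r)%:R) V0.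
  rewrite (_ : \sum_v _ = 1) ?expr1n ?mul1r => [<-|].
    congr (\det _); rewrite /L /Er !tr_finmx !mul_finmx.
    apply/matrixP => i j; rewrite !mxE; congr (_ + _).
    by rewrite (big_pred1 tt) => [|[] //]; rewrite !rmorph_nat.
  rewrite (bigD1 r) //= eqxx big1 ?addr0 // => v /negbTE -> //.
have tauC : \det (X + 3%:M - S *m S^T + S *m Er *m S^T)
    = 9%:R * #|trees trunc_src trunc_dst|%:R.
  have := @kirchhoff_rat _ _ trunc_src trunc_dst (fun a => (p a == r)%:R) C0.
  have -> : (\sum_a ((p a == r)%:R : int))%:~R = 3%:R :> rat.
    by rewrite rmorph_sum -(fiber_card r) /=; apply: eq_bigr => a _; rewrite rmorph_nat.
  move=> <-; congr (\det _); rewrite -lapE.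
  have -> : S *m Er *m S^T = (S *m ev) *m (S *m ev)^T by rewrite /Er trmx_mul !mulmxA.
  rewrite !(tr_finmx, mul_finmx); apply/matrixP => i j; rewrite !mxE; congr (_ + _).
  rewrite (big_pred1 tt) => [|[] //].
  have e (a : C) : \sum_v (p a == v)%:R * (v == r)%:R = (p a == r)%:R :> rat.
    exact: (sum_eq_op (fun v => (v == r)%:R)).
  by rewrite !e !rmorph_nat.
(* Factoring out N leaves the identity plus a product through V, so [det_add1_mulC] replaces a
   determinant of size C by one of size V. *)
have key : X + 3%:M - S *m S^T + S *m Er *m S^T
   = N *m (1%:M + (- (Ni *m S)) *m ((1%:M - Er) *m S^T)).
  rewrite mulmxDr mulmx1 mulNmx mulmxN !mulmxA NNi mul1mx /N.
  by rewrite mulmxBr mulmx1 mulmxBl opprB /Er !mulmxA addrAC -[LHS]addrA.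
have K1 : 1%:M + ((1%:M - Er) *m S^T) *m (- (Ni *m S)) = c *: L + Er - c *: (Er *m L).
  rewrite mulmxN -mulmxA StNiS mulmxBl mul1mx mulmxBr mulmx1 -scalemxAr !opprB.
  by rewrite addrCA; apply/matrixP => i j; rewrite !mxE; ring.
(* A row operation of determinant 1: the rows of L add up to 0, so those of L + Er add up to the
   unit row at r, which then replaces row r. *)
have M1 : (1%:M + ev *m (one - ev^T)) *m (L + Er) = L + Er - Er *m L.
  rewrite mulmxDl mul1mx -mulmxA mulmxBl [one *m _]mulmxDr oneL add0r.
  have -> : one *m Er = ev^T by rewrite /Er mulmxA onee mul1mx.
  have -> : ev^T *m (L + Er) = ev^T *m L + ev^T.
    by rewrite mulmxDr /Er mulmxA ete mul1mx.
  rewrite opprD addrCA subrr addr0 mulmxN mulmxA.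
  done.
(* Row r of the right-hand factor is the unit row at r. Scaling by c leaves c there, and the factor
   1 + 14 = 15 at r brings it back to 1. *)
have M2 : (c *: (1%:M + (14%:R *: ev) *m ev^T)) *m (L + Er - Er *m L)
   = c *: L + Er - c *: (Er *m L).
  have ErY : Er *m (L + Er - Er *m L) = Er.
    by rewrite mulmxBr mulmxDr ErEr [Er *m (Er *m L)]mulmxA ErEr addrAC subrr add0r.
  rewrite -scalemxAl -[14 *: ev *m _]scalemxAl -/Er mulmxDl mul1mx -scalemxAl ErY.
  by apply/matrixP => i j; rewrite !mxE /c; field.
have d1 : \det (1%:M + ev *m (one - ev^T)) = 1.
  by rewrite rank1 mulmxBl onee ete subrr addr0 det1.
have d2 : \det (c *: (1%:M + (14%:R *: ev) *m ev^T)) = c ^+ #|V| * 15%:R.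
  rewrite detZ rank1 -scalemxAr ete scale_scalar_mx -raddfD /= det_scalar.
  by rewrite cu expr1; congr (_ * _); ring.
have fin : 9%:R * #|trees trunc_src trunc_dst|%:R
   = 3%:R ^+ #|C| * (5%:R / 3%:R) ^+ #|E| * (c ^+ #|V| * 15%:R * #|trees s t|%:R) :> rat.
  rewrite -tauC key det_mulmx detN det_add1_mulC K1 -M2 det_mulmx d2.
  by rewrite -M1 det_mulmx d1 mul1r tauV.
have F : (#|trees trunc_src trunc_dst|%:R : rat)
   = (5%:R / 3%:R) ^+ #|E|.+1 * (9%:R / 5%:R) ^+ #|V| * #|trees s t|%:R.
  have n9 : (9%:R : rat) != 0 by [].
  apply: (mulfI n9); rewrite fin card_trunc_vertices exprM /c.
  have -> : (9%:R / 5%:R : rat) ^+ #|V| = (3%:R ^+ 3) ^+ #|V| * 15%:R^-1 ^+ #|V|.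
    by rewrite -exprMn; congr (_ ^+ _); field.
  rewrite [(5 / 3) ^+ #|E|.+1]exprS; move: (_ ^+ #|V|) (_ ^+ #|V|) (_ ^+ #|E|) (#|trees s t|%:R) => x y z w.
  by field.
apply/eqP; rewrite -(eqr_nat rat); apply/eqP.
rewrite !(natrM, natrX) F !expr_div_n.
have n3 : (3%:R : rat) ^+ #|E|.+1 != 0 by rewrite expf_neq0.
have n5 : (5%:R : rat) ^+ #|V| != 0 by rewrite expf_neq0.
by field; rewrite n3 n5.
Qed.
End Truncation.

Section TruncationConnected.
Variables (V E C : finType) (s t : E -> V) (p : C -> V) (rho : C -> C).
Variables (sg ta : E -> C).
Hypothesis psg : forall e, p (sg e) = s e.
Hypothesis pta : forall e, p (ta e) = t e.
Hypothesis fiber : forall a b,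
  (p a == p b : nat) = ((a == b) + (rho a == b) + (rho b == a))%N.

(** A path lifts edge by edge; between two lifted edges one moves along the triangle over their
    common vertex. *)
Lemma connected_truncation : connected_by s t setT ->
  connected_by (trunc_src sg) (trunc_dst rho ta) setT.
Proof.
move=> /connected_byP co; apply/connected_byP => a b.
set e' := adj_by _ _ _.
have side x y : p x = p y -> connect e' x y.
  move=> pxy; have := fiber x y; rewrite pxy eqxx.
  case: eqP => [-> _|_]; first exact: connect0.
  case: eqP => [<- _|_].
    by apply: connect1; apply: (@adj_by_edge _ _ (trunc_src sg) (trunc_dst rho ta) setT (inr x)).
  case: eqP => [<- _|//].
  apply: connect1; rewrite /e' adj_by_sym.
  by apply: (@adj_by_edge _ _ (trunc_src sg) (trunc_dst rho ta) setT (inr y)).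
have old e : adj_by (trunc_src sg) (trunc_dst rho ta) setT (sg e) (ta e).
  by apply: (@adj_by_edge _ _ (trunc_src sg) (trunc_dst rho ta) setT (inl e)).
have [q] := connectP (co (p a) (p b)).
elim: q a => [|v q IH] a /=; first by move=> _ /esym/side.
move=> /andP[/exists_inP[e _ ste] pth] lst.
have [c [c1 c2]] : exists c, p c = v /\ connect e' a c.
  case/orP: ste => /andP[/eqP pa /eqP ->].
    exists (ta e); split=> //; apply: connect_trans (connect1 (old e)).
    by apply: side; rewrite psg.
  exists (sg e); split=> //; apply: (@connect_trans _ _ (ta e)).
    by apply: side; rewrite pta.
  by apply: connect1; rewrite /e' adj_by_sym.
by apply: connect_trans c2 _; apply: IH; rewrite c1.
Qed.
End TruncationConnected.

(** * Free edge sets and subgraphs *)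

Section FreeSets.
Variables (V E : finType) (s t : E -> V).
Implicit Types (T F : {set E}).
Local Notation inc := (incidence s t rat).

(** Linear independence of the incidence rows: the forests, in a form suited to rank arguments. *)
Definition free_set T : Prop :=
  forall a : E -> rat, (forall v, \sum_(e in T) a e * inc e v = 0) ->
  forall e, e \in T -> a e = 0.

Definition inc_mx T : 'M[rat]_(#|T|, #|V|) :=
  \matrix_(i, j) inc (enum_val i) (enum_val j).

Lemma free_set_row_free T : free_set T <-> row_free (inc_mx T).
Proof.
split=> [fT|rf a aT e eT].
  rewrite -kermx_eq0; apply/eqP/row_matrixP => i; rewrite row0.
  have : row i (kermx (inc_mx T)) *m inc_mx T = 0 by rewrite -row_mul mulmx_ker row0.
  set w := row _ _ => wT; apply/rowP => j; rewrite [RHS]mxE.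
  pose a e := \sum_(j : 'I_#|T|) (enum_val j == e)%:R * w 0 j.
  have aE l : a (enum_val l) = w 0 l.
    rewrite /a (bigD1 l) //= eqxx mul1r big1 ?addr0 // => k /negbTE kl.
    by rewrite (inj_eq enum_val_inj) kl mul0r.
  rewrite -aE; apply: fT; last exact: enum_valP.
  move=> v; rewrite big_enum_val /=.
  move/rowP: wT => /(_ (enum_rank v)); rewrite !mxE => H; rewrite -[RHS]H.
  by apply: eq_bigr => l _; rewrite aE !mxE enum_rankK.
pose w : 'rV_#|T| := \row_i a (enum_val i).
have /(row_free_inj rf) /rowP /(_ (enum_rank_in eT e)) : w *m inc_mx T = 0 *m inc_mx T.
  rewrite mul0mx; apply/rowP => j; rewrite !mxE -[RHS](aT (enum_val j)) [RHS]big_enum_val.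
  by apply: eq_bigr => i _; rewrite !mxE.
by rewrite !mxE enum_rankK_in.
Qed.

Lemma inc_mx_const T : inc_mx T *m const_mx 1 = 0 :> 'cV_#|T|.
Proof.
apply/colP => i; rewrite !mxE; under eq_bigr do rewrite !mxE.
rewrite -(big_enum_val (fun v => inc (enum_val i) v * 1)) /=.
by rewrite (sum_incidence s t (fun=> 1)) subrr.
Qed.

(** Constant vectors lie in the kernel of the incidence matrix, so its rank stays below |V|. *)
Lemma free_set_card T : (0 < #|V|)%N -> free_set T -> (#|T| < #|V|)%N.
Proof.
move=> V0 /free_set_row_free /eqP <-.
have := mulmx0_rank_max (inc_mx_const T).
have : (0 < \rank (const_mx 1%R : 'cV[rat]_#|V|))%N.
  rewrite lt0n mxrank_eq0; apply/eqP => /colP /(_ (Ordinal V0)).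
  by rewrite !mxE.
by lia.
Qed.

(** By the path coefficients, the incidence rows together with the unit vector at r span the whole
    space. *)
Lemma connected_rank T : (0 < #|V|)%N -> connected_by s t T ->
  (#|V| <= (\rank (inc_mx T)).+1)%N.
Proof.
move=> /card_gt0P[r _] /connected_byP co.
pose er : 'rV[rat]_#|V| := \row_j (r == enum_val j)%:R.
have full : (1%:M <= inc_mx T + er)%MS.
  apply/row_subP => i; have [a [_ aE]] := connect_coeff (co r (enum_val i)).
  have -> : row i 1%:M = \row_(j < #|T|) (a (enum_val j))%:~R *m inc_mx T + er.
    apply/rowP => j; rewrite !mxE.
    have := congr1 (fun x : int => x%:~R : rat) (aE (enum_val j)).
    rewrite rmorphB /= !rmorph_nat (inj_eq enum_val_inj) => H.
    apply/eqP; rewrite -subr_eq -H; apply/eqP.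
    rewrite rmorph_sum big_enum_val /=; apply: eq_bigr => l _.
    by rewrite !mxE rmorphM /incidence !rmorphB /= !rmorph_nat.
  by rewrite addmx_sub_adds ?submxMl.
have := mxrankS full; rewrite mxrank1 => /leq_trans; apply.
apply: leq_trans (mxrank_adds_leqif _ _) _.
by rewrite -(addn1 (\rank _)) leq_add2l rank_leq_row.
Qed.

Lemma connected_card T : (0 < #|V|)%N -> connected_by s t T -> (#|V| <= #|T|.+1)%N.
Proof.
by move=> V0 co; apply: leq_trans (connected_rank V0 co) _; rewrite ltnS rank_leq_row.
Qed.

Lemma trees_free T : (0 < #|V|)%N -> T \in trees s t -> free_set T.
Proof.
move=> V0; rewrite inE => /andP[co /eqP cT]; apply/free_set_row_free.
by rewrite /row_free eqn_leq rank_leq_row /= -ltnS cT connected_rank.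
Qed.

Lemma connected_free_trees T : (0 < #|V|)%N -> connected_by s t T -> free_set T ->
  T \in trees s t.
Proof.
by move=> V0 co fT; rewrite inE co eqn_leq free_set_card // connected_card.
Qed.

(* Summing a dependency over the vertices of a component of [T :\ e] leaves
   only the contribution of [e]. *)
Lemma cut_dependency (P : pred V) T (a : E -> rat) e :
  (forall v, \sum_(f in T) a f * inc f v = 0) -> e \in T ->
  (forall f, f \in T -> f != e -> P (s f) = P (t f)) -> P (s e) != P (t e) ->
  a e = 0.
Proof.
move=> dep eT sideP; have : \sum_v (\sum_(f in T) a f * inc f v) * (P v)%:R = 0.
  by rewrite big1 // => v _; rewrite dep mul0r.
under eq_bigr do rewrite big_distrl /=.
rewrite exchange_big /= (bigD1 e) //= [X in _ + X]big1 ?addr0 => [|f /andP[fT fe]].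
  under eq_bigr do rewrite -mulrA.
  rewrite -big_distrr /= (sum_incidence s t (fun v => (P v)%:R)).
  move=> /eqP; rewrite mulf_eq0 => /orP[/eqP //|]; rewrite subr_eq0 => /eqP H /eqP[].
  by move: H; do 2!case: (P _).
under eq_bigr do rewrite -mulrA.
rewrite -big_distrr /= (sum_incidence s t (fun v => (P v)%:R)).
by rewrite sideP ?subrr ?mulr0.
Qed.

Lemma free_of_bridges T :
  (forall e, e \in T -> ~~ connect (adj_by s t (T :\ e)) (s e) (t e)) -> free_set T.
Proof.
move=> br a dep e eT.
apply: (@cut_dependency (connect (adj_by s t (T :\ e)) (s e)) T a e) => // [f fT fe|].
  by apply: connect_edge; rewrite !inE fe.
by rewrite connect0 eq_sym eqb_id br.
Qed.

(** As long as F does not connect all vertices, connectedness of the graph provides an edge leaving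
    a component of F, and by [cut_dependency] adding this edge keeps the set free. The size bound
    [free_set_card] makes the process stop. *)
Lemma free_extend F : (0 < #|V|)%N -> connected_by s t setT -> free_set F ->
  exists2 T, T \in trees s t & F \subset T.
Proof.
move=> V0 /connected_byP co; have [n] := ubnP (#|V| - #|F|).
elim: n F => // n IH F cF fF.
case: (boolP (connected_by s t F)) => [coF|/forallPn[a /forallPn[b nab]]].
  by exists F => //; apply: connected_free_trees.
pose C := connect (adj_by s t F) a.
have [e eC] : exists e, C (s e) != C (t e).
  apply/existsP; apply: contraNT nab => /existsPn H.
  have clC : closed (adj_by s t setT) C.
    apply: intro_closed; first exact: connect_by_sym.
    move=> x y /exists_inP[e _ /orP[]/andP[/eqP-> /eqP->]];
      by have := H e; rewrite negbK /in_mem /= => /eqP ->.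
  by have := closed_connect clC (co a b); rewrite /in_mem /= /C connect0 => <-.
have eF : e \notin F.
  by apply: contra eC => eF; rewrite /C (connect_edge s t _ eF).
have feF : free_set (e |: F).
  move=> c dep; have ce : c e = 0.
    apply: (@cut_dependency C (e |: F) c e) => //; first exact: setU11.
    move=> f; rewrite !inE => /orP[->//|fF' _]; exact: connect_edge.
  move=> f; rewrite !inE => /orP[/eqP -> //|fF'].
  apply: (fF c) => // v; rewrite -[RHS](dep v) big_setU1 //= ce mul0r add0r.
  by [].
have cle := free_set_card V0 feF; have cle' : (#|e |: F| = #|F|.+1)%N by rewrite cardsU1 eF.
have [|T tT sT] := IH _ _ feF; first by rewrite cle'; lia.
by exists T => //; apply: subset_trans sT; apply: subsetUr.
Qed.

Lemma trees_gt0 : (0 < #|V|)%N -> connected_by s t setT -> (0 < #|trees s t|)%N.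
Proof.
move=> V0 co; have [|T tT _] := @free_extend set0 V0 co.
  by move=> a _ e; rewrite inE.
by apply/card_gt0P; exists T.
Qed.
End FreeSets.

(** * Spanning trees of a graph and of a larger graph *)

Section Subgraph.
Variables (V E : finType) (s t : E -> V) (V' E' : finType) (s' t' : E' -> V').
Variables (j : V -> V') (i : E -> E').
Hypotheses (j_inj : injective j) (i_inj : injective i).
Hypothesis s'i : forall e, s' (i e) = j (s e).
Hypothesis t'i : forall e, t' (i e) = j (t e).
Hypothesis V0 : (0 < #|V|)%N.
Hypothesis co : connected_by s t setT.
Hypothesis co' : connected_by s' t' setT.

Lemma free_imset F : free_set s t F -> free_set s' t' (i @: F).
Proof.
move=> fF a dep _ /imsetP[e eF ->]; apply: (fF (a \o i)) => // v /=.
rewrite -[RHS](dep (j v)) big_imset /=; last by move=> x y _ _; apply: i_inj.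
by apply: eq_bigr => f _; rewrite /incidence s'i t'i !(inj_eq j_inj).
Qed.

Lemma free_preimset T : free_set s' t' T -> free_set s t (i @^-1: T).
Proof.
move=> fT a dep e; rewrite inE => eT.
pose a' e' := \sum_(f in i @^-1: T) (i f == e')%:R * a f.
have a'E f : i f \in T -> a' (i f) = a f.
  move=> fT'; rewrite /a' (bigD1 f) ?inE //= eqxx mul1r big1 ?addr0 // => g /andP[_ /negbTE gf].
  by rewrite (inj_eq i_inj) gf mul0r.
rewrite -(a'E e) //; apply: fT => // v'.
transitivity (\sum_(f in i @^-1: T) a f * incidence s' t' rat (i f) v').
  rewrite /a'; under eq_bigr do rewrite big_distrl /=.
  rewrite exchange_big /=; apply: eq_bigr => f; rewrite inE => fT'.
  rewrite (bigD1 (i f)) //= eqxx mul1r big1 ?addr0 // => g /andP[_ /negbTE gf].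
  by rewrite eq_sym gf !mul0r.
case: (boolP [exists v, v' == j v]) => [/existsP[v /eqP ->]|/existsPn nv].
  rewrite -[RHS](dep v); apply: eq_bigr => f _.
  by rewrite /incidence s'i t'i !(inj_eq j_inj).
rewrite big1 // => f _; rewrite /incidence s'i t'i.
by rewrite !(eq_sym (j _)) !(negbTE (nv _)) subrr mulr0.
Qed.

Let V'0 : (0 < #|V'|)%N.
Proof. by case/card_gt0P: V0 => v _; apply/card_gt0P; exists (j v). Qed.

(** A tree of the small graph extends to a tree T' of the large one and is recovered as the preimage
    of T', since that preimage is free and cannot have more edges. So the preimage map reaches every
    small tree. *)
Lemma trees_le_supergraph : (#|trees s t| <= #|trees s' t'|)%N.
Proof.
apply: leq_trans (leq_imset_card (fun T : {set E'} => i @^-1: T) (mem (trees s' t'))).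
apply/subset_leq_card/subsetP => T tT.
have [T' tT' sT] := free_extend V'0 co' (free_imset (trees_free V0 tT)).
apply/imsetP; exists T' => //; apply/eqP; rewrite eqEcard; apply/andP; split.
  by apply/subsetP => e eT; rewrite inE (subsetP sT) // imset_f.
have := free_set_card V0 (free_preimset (trees_free V'0 tT')).
by move: tT; rewrite inE => /andP[_ /eqP <-]; rewrite ltnS.
Qed.

(** A large tree T' is encoded by three data: a small tree T extending its restriction F, its set of
    new edges (at most 2^k choices), and a list of length k of the edges of T to delete to get back
    F (at most (|E| + 1)^k choices, [None] being padding). *)
Lemma trees_supergraph_le k : (#|E'| <= #|E| + k)%N ->
  (#|trees s' t'| <= #|trees s t| * (2 * #|E|.+1) ^ k)%N.
Proof.
move=> Ek; pose X := ~: (i @: setT).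
have cX : (#|X| <= k)%N.
  by have := cardsC (i @: setT); rewrite card_imset // cardsT /X; lia.
pose dom := setX (setX (trees s t) (powerset X)) [set: {ffun 'I_k -> option E}].
pose h (x : {set E} * {set E'} * {ffun 'I_k -> option E}) : {set E'} :=
  (i @: [set e in x.1.1 | Some e \notin codom x.2]) :|: x.1.2.
have -> : (#|trees s t| * (2 * #|E|.+1) ^ k = #|trees s t| * 2 ^ k * #|{ffun 'I_k -> option E}|)%N.
  by rewrite expnMn mulnA card_ffun card_option card_ord.
apply: (@leq_trans #|dom|); last first.
  rewrite !cardsX cardsT card_powerset leq_mul2r leq_mul2l leq_exp2l // cX !orbT.
  by [].
apply: leq_trans (leq_imset_card h (mem dom)).
apply/subset_leq_card/subsetP => T' tT'.
have fF := free_preimset (trees_free V'0 tT').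
set F := i @^-1: T' in fF.
have [T tT FT] := free_extend V0 co fF.
pose Y := T :\: F.
(* T has |V| - 1 edges, while F keeps all but at most k of the |V'| - 1 edges of T', and |V| <=
   |V'|. *)
have cY : (#|Y| <= k)%N.
  have : (#|T'| <= #|F| + #|X|)%N.
    rewrite -(card_imset F i_inj); apply: leq_trans (leq_card_setU _ _).
    apply/subset_leq_card/subsetP => e' e'T; rewrite !inE.
    case: (boolP (e' \in i @: setT)) => [/imsetP[e _ e'E]|]; last by rewrite orbT.
    by rewrite e'E imset_f // inE -e'E.
  move: tT tT'; rewrite !inE => /andP[_ /eqP cT] /andP[_ /eqP cT'].
  have : (#|V| <= #|V'|)%N by apply: leq_card j_inj.
  have := cardsD T F; rewrite (setIidPr FT) /Y; lia.
apply/imsetP; exists (T, T' :&: X, [ffun l : 'I_k => nth None (map Some (enum Y)) l]).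
  by rewrite !in_setX tT powersetE subsetIr in_setT.
apply/setP => e'; rewrite !inE /=.
case: (boolP (e' \in i @: setT)) => [/imsetP[e _ ->]|ne]; last first.
  rewrite andbT [X in _ = X || _](_ : _ = false) //.
  by apply: contraNF ne => /imsetP[e _ ->]; rewrite imset_f.
rewrite andbF orbF mem_imset // !inE.
have -> : (Some e \in codom [ffun l : 'I_k => nth None (map Some (enum Y)) l]) = (e \in Y).
  apply/codomP/idP => [[l]|eY].
    rewrite ffunE; case: (ltnP l (size (map Some (enum Y)))) => lY.
      move=> H; have := mem_nth None lY; rewrite -H mem_map ?mem_enum //; exact: Some_inj.
    by rewrite nth_default.
  have eY' : e \in enum Y by rewrite mem_enum.
  have lt : (index e (enum Y) < k)%N.
    by apply: leq_trans cY; rewrite cardE index_mem.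
  exists (Ordinal lt); rewrite ffunE /= (nth_map e) ?index_mem // nth_index //.
rewrite !inE; have := subsetP FT e; rewrite inE.
by case: (i e \in T') => /= [->//|_]; case: (e \in T).
Qed.
End Subgraph.

From mathcomp Require Import finmap.
From mathcomp Require Import all_classical all_reals all_analysis.
From mathcomp Require Import measurable_realfun.

(** * Finite pieces of lattice graphs *)

Section Transfer.
Variables (X : multigraph) (V E : finType) (s t : E -> V).
Variables (jV : V -> gvert X) (jE : E -> gedge X) (W : {fset gvert X}).
Hypotheses (jV_inj : injective jV) (jE_inj : injective jE).
Hypothesis WP : forall x, reflect (exists v, x = jV v) (x \in W).
Hypothesis EP : forall e, reflect (exists f, e = jE f) (e \in induced_edge W).
Hypothesis tail_s : forall e, tail (jE e, false) = jV (s e).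
Hypothesis tail_t : forall e, tail (jE e, true) = jV (t e).

Let end_of e (b : bool) := if b then t e else s e.

Let tailE e b : tail (jE e, b) = jV (end_of e b).
Proof. by case: b; rewrite ?tail_s ?tail_t. Qed.

Let headE e b : Defs.head (jE e, b) = jV (end_of e (~~ b)).
Proof. exact: tailE. Qed.

Let adj_end (T : {set E}) e b : e \in T -> adj_by s t T (end_of e b) (end_of e (~~ b)).
Proof.
by move=> eT; case: b; rewrite /= ?(adj_by_sym _ _ _ (t e)); apply: adj_by_edge.
Qed.

(** The walk comes with its edges and tails and with the distinctness of its edges, because
    [acyclic] asks for both kinds of distinctness. *)
Let path_walk (T : {set E}) x p : path (adj_by s t T) x p ->
  exists w, [/\ walk (jV x) w (jV (last x p)),
    forall d, d \in w -> exists e, [/\ d.1 = jE e, e \in T, s e \in x :: p & t e \in x :: p],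
    [seq tail d | d <- w] = [seq jV y | y <- belast x p]
    & uniq (x :: p) -> uniq [seq d.1 | d <- w]].
Proof.
elim: p x => [|y p IH] x /=; first by exists [::]; split=> //=.
case/andP=> /exists_inP[e eT xy] /IH[w [wk wE wt wu]].
have [b [xe ye]] : exists b, x = end_of e b /\ y = end_of e (~~ b).
  by case/orP: xy => /andP[/eqP-> /eqP->]; [exists false|exists true].
exists ((jE e, b) :: w); split=> [|d|/=|] /=.
- by rewrite tailE headE -xe -ye eqxx.
- rewrite inE => /orP[/eqP ->|/wE[f [df fT sf tf]]]; last first.
    by exists f; split=> //; rewrite inE ?sf ?tf orbT.
  exists e; split=> //; move: xe ye; case: b => /= -> ->; by rewrite !inE eqxx ?orbT.
- by rewrite wt tailE xe.
- case/andP=> xp up; rewrite wu // andbT; apply/mapP => -[d /wE[f [df _ sf tf]] /= ed].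
  have ef : e = f by apply: jE_inj; rewrite ed.
  subst f; move/negP: xp; apply; rewrite xe.
  by case: (b) sf tf.
Qed.

Lemma joined_connect (TE : {pred gedge X}) (T : {set E}) u v :
  (forall e, (jE e \in TE) = (e \in T)) ->
  joined (mem W) TE (jV u) (jV v) <-> connect (adj_by s t T) u v.
Proof.
move=> TET; split=> [[p []]|/connectP[p pth ->]].
  elim: p u => [|[e b] p IH] u /=; first by move=> /eqP/jV_inj ->.
  case/andP=> /eqP td wk /andP[eT pT] /andP[/andP[tW hW] pW].
  have [f ef] : exists f, e = jE f.
    apply/EP; rewrite inE; move: tW hW; rewrite /Defs.head /rev_dart.
    by case: b {td wk} => /= -> ->.
  subst e; move: td wk; rewrite tailE headE => /jV_inj <- wk.
  apply: connect_trans (connect1 (adj_end b _)) (IH _ wk pT pW).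
  by rewrite -TET.
have [w [wk wE _ _]] := path_walk pth.
exists w; split=> //; apply/allP => -[e b] /wE[f [/= -> fT _ _]].
  by rewrite TET.
rewrite tailE headE; apply/andP; split; apply/WP; eexists; reflexivity.
Qed.

Lemma linked_connected (TE : {pred gedge X}) (T : {set E}) :
  (forall e, (jE e \in TE) = (e \in T)) ->
  linked (mem W) TE <-> connected_by s t T.
Proof.
move=> TET; split=> [lk|/connected_byP co x y /WP[u ->] /WP[v ->]].
  apply/connected_byP => u v; apply/(joined_connect _ _ TET); apply: lk;
  by apply/WP; eexists; reflexivity.
exact/(joined_connect _ _ TET).
Qed.

Let img (T : {set E}) : {fset gedge X} := [fset jE e | e in T]%fset.

Let in_img T e : (jE e \in img T) = (e \in T).
Proof. by rewrite mem_imfset. Qed.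

(** A simple path joining the ends of e without using e is closed up by e to a nonempty cycle. *)
Let acyclic_bridges T : acyclic (mem (img T)) ->
  forall e, e \in T -> ~~ connect (adj_by s t (T :\ e)) (s e) (t e).
Proof.
move=> ac e eT; apply/negP => /connectP[p0 pth0].
case/shortenP: pth0 => p pth up _ tl.
have [w [wk wE wt wu]] := path_walk pth.
suff : (jE e, true) :: w = [::] by [].
apply: (ac (jV (t e))) => /=.
- by rewrite tailE headE eqxx /=; move: wk; rewrite -tl.
- rewrite -[_ \in _]/(jE e \in img T) in_img eT /=; apply/allP => d /wE[f [-> fT _ _]].
  by rewrite -[_ \in _]/(jE f \in img T) in_img; move: fT; rewrite !inE => /andP[].
- rewrite wu // andbT; apply/mapP => -[d /wE[f [df fT _ _]] /= ed].
  move: fT; rewrite !inE (_ : f = e) ?eqxx //.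
  by apply: jE_inj; rewrite ed.
- move: up; rewrite wt tailE lastI rcons_uniq -tl => /andP[nb ub].
  by rewrite map_inj_uniq // ub andbT mem_map.
Qed.

(** The signed edge counts of a closed walk form a dependency. The edges being distinct, the first
    one has coefficient 1 or -1, so the walk must be empty. *)
Let free_acyclic T : free_set s t T -> acyclic (mem (img T)).
Proof.
move=> fT u p wk pT uE _.
pose sgn (d : gedge X * bool) : rat := if d.2 then -1 else 1.
pose a e := \sum_(d <- p) (d.1 == jE e)%:R * sgn d.
have imgP d : d \in p -> exists2 e, e \in T & d.1 = jE e.
  by move=> dp; have /imfsetP[e eT ->] := allP pT _ dp; exists e.
have a0 : forall e, e \in T -> a e = 0.
  apply: fT => v.
  transitivity (\sum_(d <- p) ((tail d == jV v)%:R - (Defs.head d == jV v)%:R) : rat).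
    rewrite /a; under eq_bigr do rewrite big_distrl /=.
    rewrite exchange_big /= big_seq [RHS]big_seq; apply: eq_bigr => d dp.
    have [e eT de] := imgP d dp.
    rewrite (bigD1 e) //= de eqxx mul1r big1 ?addr0 => [|f /andP[_ /negbTE fe]].
      case: d {dp} de => _ b /= ->; rewrite tailE headE /incidence /sgn.
      by case: b; rewrite /= !(inj_eq jV_inj); ring.
    by rewrite (inj_eq jE_inj) eq_sym fe !mul0r.
  have tele q x y : walk x q y -> \sum_(d <- q) ((tail d == jV v)%:R - (Defs.head d == jV v)%:R)
      = (x == jV v)%:R - (y == jV v)%:R :> rat.
    elim: q x => [|d q IH] x /=; first by move/eqP->; rewrite big_nil subrr.
    by case/andP=> /eqP <- /IH; rewrite big_cons => ->; ring.
  by rewrite (tele _ _ _ wk) subrr.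
move: a0; rewrite /a => {a}; case: p {wk pT} uE imgP => // d p /= /andP[dp _] imgP a0.
have [e eT de] := imgP d (mem_head _ _).
have := a0 e eT; rewrite big_cons de eqxx mul1r big_seq big1 ?addr0 /sgn.
  by case: d.2.
move=> d' d'p; case: eqP => [d'e|]; last by rewrite mul0r.
by case/negP: dp; rewrite de -d'e map_f.
Qed.

(** For a connected edge set, acyclic implies that every edge is a bridge, hence free, hence of size
    |V| - 1; conversely trees are free, hence acyclic. *)
Lemma nb_spanning_treesE : (0 < #|V|)%N -> nb_spanning_trees W = #|trees s t|.
Proof.
move=> V0.
have img_inj : injective img.
  by move=> T1 T2 e12; apply/setP => e; rewrite -!in_img e12.
have treeP T : spanning_tree W (img T) <-> T \in trees s t.
  have lk := @linked_connected (mem (img T)) T (in_img T).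
  split=> [[_ /lk co /acyclic_bridges br]|tT].
    by apply: connected_free_trees => //; apply: free_of_bridges.
  split; last exact/free_acyclic/trees_free.
    by move=> _ /imfsetP[e _ ->]; apply/EP; exists e.
  by apply/lk; move: tT; rewrite inE => /andP[].
rewrite /nb_spanning_trees.
rewrite (_ : [set T | spanning_tree W T]%classic = [set` [fset img T | T in trees s t]%fset]%classic).
  by rewrite set_fsetK card_imfset //= -cardE.
apply/seteqP; split=> T /=.
  move=> sT; have [sub _ _] := sT.
  have TE : T = img [set e | jE e \in T].
    apply/fsetP => e; apply/idP/imfsetP => [eT|[f /=]]; last by rewrite inE => ? ->.
    by have /EP[f ef] := sub e eT; exists f => //; rewrite inE -ef.
  by apply/imfsetP; exists [set e | jE e \in T] => //; apply/treeP; rewrite -TE.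
by case/imfsetP => T' /treeP ? ->.
Qed.
End Transfer.

Definition in_box (n : nat) (x : int * int) : bool :=
  [&& - (n./2)%:Z <= x.1, x.1 < n%:Z - (n./2)%:Z,
      - (n./2)%:Z <= x.2 & x.2 < n%:Z - (n./2)%:Z].

Definition bounded_by (K : nat) (x : int * int) : bool :=
  (`|x.1| <= K%:Z) && (`|x.2| <= K%:Z).

Lemma in_boxP n x : reflect (exists ij, x = window (n := n) ij) (in_box n x).
Proof.
case: x => x y; apply: (iffP and4P) => /= [[h1 h2 h3 h4]|[[i j] [-> ->]]].
  have hi : (`|(x + (n./2)%:Z)%R| < n)%N by lia.
  have hj : (`|(y + (n./2)%:Z)%R| < n)%N by lia.
  by exists (Ordinal hi, Ordinal hj); rewrite /window /=; congr pair; lia.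
by have := ltn_ord i; have := ltn_ord j; split; lia.
Qed.

Lemma window_inj n : injective (@window n).
Proof. by move=> [i j] [i' j'] [] h1 h2; congr pair; apply: val_inj => /=; lia. Qed.

(** Enlarging by the even number [K.*2] shifts [n./2] by exactly K, so the window grows by K on each
    side and stays centred. *)
Lemma in_boxD n K x y : in_box n x -> bounded_by K y -> in_box (n + K.*2) (x + y).
Proof.
case: x y => x x' [y y']; rewrite /in_box /bounded_by /=.
by move=> /and4P[? ? ? ?] /andP[? ?]; apply/and4P; split; lia.
Qed.

Lemma exists_bound (I : finType) (f : I -> int * int) :
  exists K : nat, forall i, bounded_by K (f i).
Proof.
exists (\sum_i (`|(f i).1| + `|(f i).2|))%N => i.
by rewrite (bigD1 i) //= /bounded_by; apply/andP; split; lia.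
Qed.

(** * Induced subgraphs of the cover and change of fundamental domain *)

Section Cover.
Variable H : lattice_graph.
Local Notation cover := (cover_graph H).
Implicit Types (c : vertex H -> int * int) (W : {fset gvert cover}).

Lemma in_copies c n (w : gvert cover) : (w \in copies c n) = in_box n (w.2 - c w.1).
Proof.
case: w => v x /=; apply/imfsetP/in_boxP => /= [[[v' ij] _ [-> ->]]|[ij xE]].
  by exists ij; rewrite addrC addKr.
by exists (v, ij) => //=; rewrite -xE addrC subrK.
Qed.

Lemma card_copies c n : #|` copies c n| = (#|{: vertex H}| * n ^ 2)%N.
Proof.
rewrite card_imfset /=; last first.
  move=> [v ij] [v' ij'] /= e; have vv' : v = v' := congr1 fst e.
  by subst v'; have /addrI/window_inj -> := congr1 snd e.
by rewrite -cardE card_prod card_prod card_ord mulnn.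
Qed.

Lemma copies_gt0 c n : vertex H -> (0 < n)%N -> (0 < #|` copies c n|)%N.
Proof.
move=> v n0; rewrite card_copies muln_gt0 expn_gt0 n0 andbT.
by apply/card_gt0P; exists v.
Qed.

(** A cover edge is determined by its quotient edge and the cell where it starts, which bounds the
    search to a finite set. *)
Definition induced_edges W : {fset gedge cover} :=
  [fset p in [fset ((e, w.2) : gedge cover) | e in {: medge H}, w in W]
    | induced_edge W p]%fset.

Lemma in_induced_edges W p : (p \in induced_edges W) = (p \in induced_edge W).
Proof.
rewrite !inE /=; apply/andP/idP => [[]//|pW]; split=> //.
have /andP[+ _] := pW; case: p {pW} => e x /= h.
by apply/imfset2P; exists e => //; exists (vertex_of (M := H) (e, false), x).
Qed.

Lemma induced_src W (e : induced_edges W) : tail (val e, false) \in W.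
Proof. by have := valP e; rewrite in_induced_edges inE => /andP[]. Qed.

Lemma induced_dst W (e : induced_edges W) : tail (val e, true) \in W.
Proof. by have := valP e; rewrite in_induced_edges inE => /andP[]. Qed.

Definition src W (e : induced_edges W) : W := [` induced_src e]%fset.
Definition dst W (e : induced_edges W) : W := [` induced_dst e]%fset.

Lemma linked_induced W :
  linked (mem W) (induced_edge W) <-> connected_by (@src W) (@dst W) (finset.setTfor _).
Proof.
apply: (@linked_connected _ _ _ _ _ val val) => //; try exact: val_inj.
- move=> x; apply: (iffP idP) => [xW|[v ->]]; last exact: valP.
  by exists [` xW]%fset.
- move=> e; apply: (iffP idP) => [|[f ->]]; rewrite -in_induced_edges; last exact: valP.
  by move=> eW; exists [` eW]%fset.
- by move=> e; rewrite -in_induced_edges; rewrite [RHS]inE; apply: valP.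
Qed.

Lemma nb_spanning_trees_induced W : (0 < #|` W|)%N ->
  nb_spanning_trees W = #|trees (@src W) (@dst W)|.
Proof.
move=> W0; apply: (@nb_spanning_treesE _ _ _ _ _ val val) => //; try exact: val_inj.
- move=> x; apply: (iffP idP) => [xW|[v ->]]; last exact: valP.
  by exists [` xW]%fset.
- move=> e; apply: (iffP idP) => [|[f ->]]; rewrite -in_induced_edges; last exact: valP.
  by move=> eW; exists [` eW]%fset.
- by rewrite -[#|_|]cardfE.
Qed.

Lemma nb_spanning_trees_gt0 W : (0 < #|` W|)%N ->
  linked (mem W) (induced_edge W) -> (0 < nb_spanning_trees W)%N.
Proof.
move=> W0 /linked_induced co; rewrite nb_spanning_trees_induced //.
by apply: trees_gt0; rewrite -?cardfE.
Qed.

Lemma induced_edgesS W W' : (W `<=` W')%fset -> (induced_edges W `<=` induced_edges W')%fset.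
Proof.
move=> /fsubsetP sub; apply/fsubsetP => e; rewrite !in_induced_edges !inE.
by move=> /andP[/sub -> /sub ->].
Qed.

Lemma nb_spanning_trees_subset W W' k : (0 < #|` W|)%N -> (W `<=` W')%fset ->
  linked (mem W) (induced_edge W) -> linked (mem W') (induced_edge W') ->
  (#|` induced_edges W'| <= #|` induced_edges W| + k)%N ->
  (nb_spanning_trees W <= nb_spanning_trees W' <=
    nb_spanning_trees W * (2 * #|` induced_edges W|.+1) ^ k)%N.
Proof.
move=> W0 sub /linked_induced co /linked_induced co' Ek.
have W'0 : (0 < #|` W'|)%N by apply: leq_trans W0 (fsubset_leq_card sub).
rewrite !nb_spanning_trees_induced // [X in (2 * X.+1)%N]cardfE.
have finj (K : choiceType) (A B : {fset K}) (AB : (A `<=` B)%fset) : injective (fincl AB).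
  by move=> x y /(congr1 val) /= h; apply: val_inj.
apply/andP; split.
  apply: (@trees_le_supergraph _ _ _ _ _ _ _ _ (fincl sub) (fincl (induced_edgesS sub)));
    rewrite -?[#|_|]cardfE //; try exact: finj; by move=> e; apply: val_inj.
apply: (@trees_supergraph_le _ _ _ _ _ _ _ _ (fincl sub) (fincl (induced_edgesS sub)));
    rewrite -?[#|_|]cardfE //; try exact: finj; by move=> e; apply: val_inj.
Qed.

Lemma copies_subset c c' K n : (forall v, bounded_by K (c v - c' v)) ->
  (copies c n `<=` copies c' (n + K.*2))%fset.
Proof.
move=> bK; apply/fsubsetP => -[v x]; rewrite !in_copies /= => xn.
rewrite (_ : x - c' v = x - c v + (c v - c' v)); last by ring.
exact: in_boxD.
Qed.

Let box_edges n : {fset gedge cover} :=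
  [fset ((p.1, window p.2) : gedge cover) | p in {: medge H * ('I_n * 'I_n)}]%fset.

Let in_box_edges n p : (p \in box_edges n) = in_box n p.2.
Proof.
case: p => e x; apply/imfsetP/in_boxP => /= [[[f ij] _ H0]|[ij ->]].
  by exists ij; have := congr1 snd H0.
by exists (e, ij).
Qed.

Let card_box_edges n : #|` box_edges n| = (#|{: medge H}| * n ^ 2)%N.
Proof.
rewrite card_imfset /=; last first.
  move=> [v ij] [v' ij'] /= e; have vv' : v = v' := congr1 fst e.
  by subst v'; have /window_inj -> := congr1 snd e.
by rewrite -cardE card_prod card_prod card_ord mulnn.
Qed.

Lemma bounded_byN K x : bounded_by K (- x) = bounded_by K x.
Proof. by rewrite /bounded_by !normrN. Qed.

(** Up to a shift by at most K, the induced edges lie in the box of side n + 2 K and contain those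
    of the box of side n - 2 K. *)
Lemma card_induced_copies c : exists B, forall n, (0 < n)%N ->
  (#|` induced_edges (copies c n)| <= #|{: medge H}| * n ^ 2 + B * n)%N /\
  (#|{: medge H}| * n ^ 2 <= #|` induced_edges (copies c n)| + B * n)%N.
Proof.
have [K1 bK1] := exists_bound (fun e : medge H => c (vertex_of (M := H) (e, false))).
have [K2 bK2] := exists_bound (fun e : medge H => edge_shift e - c (vertex_of (M := H) (e, true))).
pose K := (K1 + K2)%N; pose A := #|{: medge H}|.
have wK k x : (k <= K)%N -> bounded_by k x -> bounded_by K x.
  by rewrite /bounded_by => kK /andP[? ?]; apply/andP; split; lia.
(* This absorbs (n + 2 K)^2 - n^2 = 4 K n + 4 K^2, the analogous deficit for n - 2 K, and the whole
   of n^2 when n <= 2 K. *)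
exists (A * (8 * K ^ 2 + 4 * K))%N => n n0; split.
  apply: (@leq_trans (A * (n + K.*2) ^ 2)%N); last by nia.
  rewrite -card_box_edges; apply/fsubset_leq_card/fsubsetP => -[e x].
  rewrite in_induced_edges in_box_edges inE /= => /andP[+ _].
  rewrite in_copies /= => /in_boxD/(_ (wK _ _ (leq_addr _ _) (bK1 e))).
  by rewrite subrK.
have [nK|nK] := leqP n K.*2; first by nia.
apply: (@leq_trans (A * (n - K.*2) ^ 2 + A * (8 * K ^ 2 + 4 * K) * n)%N); last first.
  rewrite leq_add2r -card_box_edges; apply/fsubset_leq_card/fsubsetP => -[e x].
  rewrite in_induced_edges in_box_edges inE /= !in_copies /= => xb.
  rewrite -{1 2}(subnK (ltnW nK)); apply/andP; split.
    by apply: in_boxD xb _; rewrite bounded_byN; apply: wK (bK1 e); rewrite leq_addr.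
  by rewrite -addrA; apply: in_boxD xb _; apply: wK (bK2 e); rewrite leq_addl.
have := subnK (ltnW nK); move: (n - K.*2)%N => m <-; nia.
Qed.

(** Both pieces of size n sit inside the piece of size n + 2 K for c, which has only O(n) more edges
    than the piece of size n for c. The factor has logarithm O(n log n), negligible against n^2;
    exchanging c and c' gives the reverse estimate. *)
Lemma compare_copies c c' : vertex H -> fundamental_domain c -> fundamental_domain c' ->
  exists B, forall n, (0 < n)%N ->
  (nb_spanning_trees (copies c' n)
    <= nb_spanning_trees (copies c n) * (B * n ^ 2) ^ (B * n))%N.
Proof.
move=> v0 fc fc'; have [K bK] := exists_bound (fun v => c' v - c v).
have [B0 B0P] := card_induced_copies c; pose A := #|{: medge H}|.
pose k n := (A * (4 * K ^ 2 + 4 * K) * n + B0 * (n + K.*2) + B0 * n)%N.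
pose B := (A * (4 * K ^ 2 + 4 * K) + B0 * (2 + K.*2) + 2 * (A + B0 + 1))%N.
exists B => n n0; set W := copies c n; set W' := copies c (n + K.*2).
have W0 m : (0 < m)%N -> (0 < #|` copies c m|)%N by move=> m0; apply: copies_gt0.
have n'0 : (0 < n + K.*2)%N by rewrite addn_gt0 n0.
have sub : (W `<=` W')%fset.
  by apply: copies_subset => v; rewrite subrr /bounded_by /= normr0.
have /andP[le1 _] := @nb_spanning_trees_subset (copies c' n) W' #|` induced_edges W'|
  (copies_gt0 c' v0 n0) (copies_subset n bK) (fc' _ n0) (fc _ n'0) (leq_addl _ _).
have Ek : (#|` induced_edges W'| <= #|` induced_edges W| + k n)%N.
  have [+ _] := B0P _ n'0; have [_] := B0P _ n0; rewrite -/W -/W' -/A /k.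
  by nia.
have := @nb_spanning_trees_subset W W' (k n) (W0 _ n0) sub (fc _ n0) (fc _ n'0) Ek.
move=> /andP[_ le2]; apply: leq_trans le1 (leq_trans le2 _).
rewrite leq_mul2l; apply/orP; right.
have base : (2 * #|` induced_edges W|.+1 <= B * n ^ 2)%N.
  have [+ _] := B0P _ n0; rewrite -/W -/A /B; move: (_ (induced_edges W)) => D; nia.
have ex : (k n <= B * n)%N.
  by rewrite /k /B; nia.
apply: (@leq_trans ((B * n ^ 2) ^ k n)).
  by have [->|k0] := posnP (k n); rewrite ?expn0 ?leq_exp2r.
by rewrite leq_pexp2l // (leq_trans _ base).
Qed.
End Cover.

Lemma vertex_of_eq (M : cmap) (d d' : medge M * bool) :
  (vertex_of d == vertex_of d') = (d' \in porbit (rotation M) d).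
Proof. by rewrite -val_eqE /= eq_sym eq_porbit_mem. Qed.

Lemma vertex_of_rotation (M : cmap) (d : medge M * bool) :
  vertex_of (rotation M d) = vertex_of d.
Proof. by apply/eqP; rewrite eq_sym vertex_of_eq; exact: (mem_porbit _ 1). Qed.

Lemma vertex_of_surj (M : cmap) (v : vertex M) : exists d, vertex_of d = v.
Proof. by have /imsetP[d _ vd] := valP v; exists d; apply: val_inj. Qed.

Section CubicMaps.
Variable M : cmap.
Hypothesis M3 : regular M 3.
Local Notation rot := (rotation M).

(** The orbit of d is d, rot d, rot^-1 d, all distinct. The form is that of the hypothesis [fiber]
    on truncations of finite graphs. *)
Lemma vertex_of_eq3 (d d' : medge M * bool) :
  (vertex_of d == vertex_of d' : nat) = ((d == d') + (rot d == d') + (rot d' == d))%N.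
Proof.
have c3 : #|porbit rot d| = 3 := M3 (vertex_of d).
have rot3 : rot (rot (rot d)) = d by have := iter_porbit rot d; rewrite c3.
have := uniq_traject_porbit rot d; rewrite c3 /= !inE negb_or andbT => /andP[/andP[h1 h2] h3].
rewrite vertex_of_eq porbit_traject c3 !inE !(eq_sym _ d').
have -> : (rot d' == d) = (d' == rot (rot d)).
  by rewrite -{1}rot3 (inj_eq perm_inj).
have [->|_] := eqVneq d' d; first by rewrite (negbTE h1) (negbTE h2).
by have [->|_] := eqVneq d' (rot d); first by rewrite (negbTE h3).
Qed.
End CubicMaps.

(** * Corners, and finite pieces of the truncation *)

Section TruncatedMap.
Variable G : lattice_graph.
Local Notation dart := (medge G * bool)%type.
Local Notation T := (truncation G).
Local Notation rot := (rotation G).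

Definition corner (d : dart) : vertex T := vertex_of (M := T) (inl d.1, d.2).

(** The dart of G at whose corner x starts. It is constant on the orbits of the rotation, which
    makes [corner] injective. *)
Definition corner_dart (x : medge T * bool) : dart :=
  match x with
  | (inl e, b) => (e, b)
  | (inr d, false) => d
  | (inr d, true) => rot d
  end.

Lemma corner_dart_rotation x : corner_dart (rotation T x) = corner_dart x.
Proof. by rewrite permE; case: x => [[e|d] []] //=; rewrite ?permKV -?surjective_pairing. Qed.

Lemma vertex_of_corner x : vertex_of (M := T) x = corner (corner_dart x).
Proof.
case: x => [[e|d] []] //=.
  by rewrite -vertex_of_rotation permE.
by rewrite /corner -[RHS]vertex_of_rotation permE /= -surjective_pairing.
Qed.

Lemma corner_inj : injective corner.
Proof.
move=> d d' /eqP; rewrite vertex_of_eq => /porbitP[i e].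
have H k x : corner_dart ((rotation T ^+ k)%g x) = corner_dart x.
  by elim: k x => [|k IH] x; rewrite ?expg0 ?perm1 // expgSr permM corner_dart_rotation IH.
have := H i (inl d.1, d.2); rewrite -e /=.
by case: d d' {e} => [? ?] [? ?] /= [-> ->].
Qed.

Lemma corner_surj y : exists d, corner d = y.
Proof. by have [x <-] := vertex_of_surj y; exists (corner_dart x); rewrite vertex_of_corner. Qed.

Definition dart_of_corner (y : vertex T) : dart := sval (cid (corner_surj y)).

Lemma dart_of_cornerK : cancel dart_of_corner corner.
Proof. by move=> y; rewrite /dart_of_corner; case: cid. Qed.

Lemma cornerK : cancel corner dart_of_corner.
Proof. by move=> d; apply: corner_inj; rewrite dart_of_cornerK. Qed.

Lemma card_vertex_truncation : #|{: vertex T}| = (2 * #|{: medge G}|)%N.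
Proof.
rewrite -(bij_eq_card (Bijective cornerK dart_of_cornerK)) card_prod card_bool mulnC.
by [].
Qed.

Lemma card_edge_truncation : #|{: medge T}| = (3 * #|{: medge G}|)%N.
Proof. by rewrite card_sum card_prod card_bool; lia. Qed.

Hypothesis G3 : regular G 3.

(** Darts play the role of corners: three over each vertex, two for each edge. *)
Lemma cubic_card : (3 * #|{: vertex G}| = 2 * #|{: medge G}|)%N.
Proof.
rewrite -(@card_trunc_vertices _ _ (@vertex_of G) rot) ?card_prod ?card_bool 1?mulnC //.
- exact: perm_inj.
- exact: vertex_of_surj.
- exact: vertex_of_eq3.
Qed.

(** All three corners are put in the cell of their vertex, so that the pieces of the truncation are
    exactly the truncations of the pieces of G. *)
Definition lift_cell (c : vertex G -> int * int) (y : vertex T) : int * int :=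
  c (vertex_of (dart_of_corner y)).

Section Window.
Variables (W : {fset gvert (cover_graph G)}) (W' : {fset gvert (cover_graph T)}).
Hypothesis W'W : forall d x, ((corner d, x) \in W') = ((vertex_of d, x) \in W).

Definition corners : {fset dart * (int * int)} :=
  [fset p in [fset (d, w.2) | d in {: dart}, w in W] | (vertex_of p.1, p.2) \in W]%fset.

Lemma in_corners d x : ((d, x) \in corners) = ((vertex_of d, x) \in W).
Proof.
rewrite !inE /=; apply/andP/idP => [[]//|dW]; split=> //.
by apply/imfset2P; exists d => //; exists (vertex_of d, x).
Qed.

Lemma cornersW (a : corners) : (vertex_of (val a).1, (val a).2) \in W.
Proof. by rewrite -in_corners -surjective_pairing; apply: valP. Qed.

Definition base (a : corners) : W := [` cornersW a]%fset.

Lemma next_corner_subproof (a : corners) : (rot (val a).1, (val a).2) \in corners.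
Proof. by rewrite in_corners vertex_of_rotation cornersW. Qed.

Definition next_corner (a : corners) : corners := [` next_corner_subproof a]%fset.

Lemma corner_src_subproof (e : induced_edges W) :
  (((val e).1, false), (val e).2) \in corners.
Proof. by rewrite in_corners; have := induced_src e; case: (val e). Qed.

Lemma corner_dst_subproof (e : induced_edges W) :
  (((val e).1, true), (val e).2 + edge_shift (val e).1) \in corners.
Proof. by rewrite in_corners; have := induced_dst e; case: (val e). Qed.

Definition corner_src (e : induced_edges W) : corners := [` corner_src_subproof e]%fset.
Definition corner_dst (e : induced_edges W) : corners := [` corner_dst_subproof e]%fset.

Let jV (a : corners) : gvert (cover_graph T) := (corner (val a).1, (val a).2).
Let jE (e : induced_edges W + corners) : gedge (cover_graph T) :=
  match e with inl e => (inl (val e).1, (val e).2) | inr a => (inr (val a).1, (val a).2) end.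

Let jV_inj : injective jV.
Proof.
move=> a b ab; have /corner_inj e1 := congr1 fst ab; have e2 : (val a).2 = (val b).2 := congr1 snd ab.
by apply: val_inj; rewrite (surjective_pairing (val a)) e1 e2 -surjective_pairing.
Qed.

Let jE_inj : injective jE.
Proof.
move=> [a|a] [b|b] ab; have := congr1 fst ab => //= -[e1];
  have e2 : (val a).2 = (val b).2 := congr1 snd ab; congr (_ _); apply: val_inj.
  by rewrite (surjective_pairing (val a)) e1 e2 -surjective_pairing.
by rewrite (surjective_pairing (val a)) e1 e2 -surjective_pairing.
Qed.

Let WP x : reflect (exists v, x = jV v) (x \in W').
Proof.
case: x => y x; rewrite -(dart_of_cornerK y) W'W -in_corners.
apply: (iffP idP) => [h|[a]]; first by exists [` h]%fset.
move=> ya; have /corner_inj -> := congr1 fst ya; have -> /= : x = (val a).2 := congr1 snd ya.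
by rewrite -surjective_pairing; apply: valP.
Qed.

Let tail_s e : tail (jE e, false) = jV (trunc_src corner_src e).
Proof. by case: e => [e|a] //=; rewrite vertex_of_corner. Qed.

Let tail_t e : tail (jE e, true) = jV (trunc_dst next_corner corner_dst e).
Proof. by case: e => [e|a] //=; rewrite vertex_of_corner /jV /= addr0. Qed.

Let EP e : reflect (exists f, e = jE f) (e \in induced_edge W').
Proof.
apply: (iffP idP) => [|[f ->]]; last first.
  by rewrite inE tail_s tail_t; apply/andP; split; apply/WP; eexists; reflexivity.
case: e => [[e|d] x]; rewrite inE => /andP[/= h1 h2].
  have eW : ((e, x) : gedge (cover_graph G)) \in induced_edges W.
    rewrite in_induced_edges inE /= -!W'W; apply/andP; split; first exact: h1.
    exact: h2.
  by exists (inl [` eW]%fset).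
have dW : (d, x) \in corners by rewrite in_corners -W'W; move: h1; rewrite vertex_of_corner.
by exists (inr [` dW]%fset).
Qed.

Let fiberW (a b : corners) : (base a == base b : nat) =
  ((a == b) + (next_corner a == b) + (next_corner b == a))%N.
Proof.
rewrite -!val_eqE /=; case: (val a) (val b) => d x [d' x'] /=.
rewrite !xpair_eqE /= !(eq_sym x').
case: (x == x'); last by rewrite !andbF.
by rewrite !andbT (vertex_of_eq3 G3).
Qed.

(** The edges induced by W' are those induced by W and every triangle side over W, including full
    triangles at border vertices some of whose edges leave W. *)
Lemma nb_spanning_trees_truncation : (0 < #|` W|)%N ->
  (nb_spanning_trees W' * (3 ^ #|` induced_edges W|.+1 * 5 ^ #|` W|)
    = nb_spanning_trees W * (5 ^ #|` induced_edges W|.+1 * 9 ^ #|` W|))%N.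
Proof.
move=> W0; rewrite (nb_spanning_treesE jV_inj jE_inj WP EP tail_s tail_t).
  rewrite nb_spanning_trees_induced // [#|` W|]cardfE [#|` induced_edges W|]cardfE.
  apply: (@trees_truncation _ _ _ _ _ base next_corner corner_src corner_dst).
  - by move=> e; apply: val_inj => /=; case: (val e).
  - by move=> e; apply: val_inj => /=; case: (val e).
  - move=> e f ef; apply: val_inj; move: (congr1 val ef) => /= -[].
    by case: (val e) (val f) => [? ?] [? ?] /= -> ->.
  - move=> e f ef; apply: val_inj; have H := congr1 val ef.
    have e1 : (val e).1 = (val f).1 := congr1 (fun z => z.1.1) H.
    have /= := congr1 snd H; rewrite e1 => /addIr e2.
    by rewrite (surjective_pairing (val e)) e1 e2 -surjective_pairing.
  - by move=> e f; rewrite -val_eqE /=; apply/eqP => -[].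
  - move=> a b ab; apply: val_inj; have H := congr1 val ab.
    have /= /perm_inj e1 := congr1 fst H; have /= e2 := congr1 snd H.
    by rewrite (surjective_pairing (val a)) e1 e2 -surjective_pairing.
  - move=> w; have [d dw] := vertex_of_surj (val w).1.
    have dW : (d, (val w).2) \in corners.
      by rewrite in_corners dw -surjective_pairing; apply: valP.
    by exists [` dW]%fset; apply: val_inj; rewrite /= dw -surjective_pairing.
  - exact: fiberW.
  - by rewrite -[#|_|]cardfE.
rewrite -[#|_|]cardfE cardfs_gt0; have /fset0Pn[w wW] : W != fset0 by rewrite -cardfs_gt0.
have [d dw] := vertex_of_surj w.1; apply/fset0Pn; exists (d, w.2).
by rewrite in_corners dw -surjective_pairing.
Qed.

Lemma linked_truncation :
  linked (mem W) (induced_edge W) -> linked (mem W') (induced_edge W').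
Proof.
move=> /linked_induced co.
apply/(linked_connected jV_inj jE_inj WP EP tail_s tail_t); last first.
  apply: (@connected_truncation _ _ _ _ _ base next_corner corner_src corner_dst) co.
  - by move=> e; apply: val_inj => /=; case: (val e).
  - by move=> e; apply: val_inj => /=; case: (val e).
  - exact: fiberW.
move=> e; rewrite [RHS]inE; apply/EP; by exists e.
Qed.
End Window.

Variable c : vertex G -> int * int.

Lemma in_copies_lift n d x :
  ((corner d, x) \in copies (lift_cell c) n) = ((vertex_of d, x) \in copies c n).
Proof. by rewrite !in_copies /= /lift_cell cornerK. Qed.

Lemma fundamental_domain_lift : fundamental_domain c -> fundamental_domain (lift_cell c).
Proof. by move=> fc n n0; apply: linked_truncation (in_copies_lift n) (fc n n0). Qed.

End TruncatedMap.

(** * Faces of the truncation *)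

(** Spreading the weight of an orbit evenly over its elements turns a sum over faces into a sum over
    darts, which can be split by kind of dart. *)
Lemma sum_porbits (R : numFieldType) (T : finType) (p : {perm T}) (g : nat -> R) :
  \sum_(f in porbits p) g #|f| = \sum_x g #|porbit p x| / #|porbit p x|%:R.
Proof.
rewrite [RHS](partition_big (porbit p) (fun f => f \in porbits p)) /=; last first.
  by move=> x _; apply: imset_f.
apply: eq_bigr => f /imsetP[y _ ->].
rewrite (eq_bigr (fun=> g #|porbit p y| / #|porbit p y|%:R)) => [|x /eqP -> //].
rewrite sumr_const -[_ *+ _]mulr_natr.
rewrite [X in _ * X%:R](_ : _ = #|porbit p y|); last first.
  by apply: eq_card => x; rewrite -eq_porbit_mem.
rewrite divfK // pnatr_eq0 -lt0n; apply/card_gt0P; exists y; exact: porbit_id.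
Qed.

Lemma porbit_subset (T : finType) (p : {perm T}) (S : {set T}) x :
  x \in S -> (forall y, y \in S -> p y \in S) -> porbit p x \subset S.
Proof.
move=> xS clS; apply/fintype.subsetP => y /porbitP[i ->].
by elim: i => [|i IH]; rewrite ?expg0 ?perm1 // expgSr permM clS.
Qed.

Lemma porbit_perm (T : finType) (p : {perm T}) x : porbit p (p x) = porbit p x.
Proof. by apply/eqP; rewrite eq_porbit_mem; exact: (mem_porbit p 1 x). Qed.

Lemma card_porbit3 (T : finType) (p : {perm T}) x :
  p (p (p x)) = x -> p x != x -> #|porbit p x| = 3.
Proof.
move=> p3 px; have -> : porbit p x = [set x; p x; p (p x)].
  apply/eqP; rewrite finset.eqEsubset; apply/andP; split.
    apply: porbit_subset; first by rewrite !inE eqxx.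
    by move=> y; rewrite !inE => /orP[/orP[]|] /eqP ->; rewrite ?p3 eqxx ?orbT.
  apply/fintype.subsetP => y; rewrite !inE -eq_porbit_mem.
  by move=> /orP[/orP[]|] /eqP ->; rewrite ?porbit_perm.
rewrite -finset.setUA !cardsU1 cards1 !inE negb_or (inj_eq perm_inj) !(eq_sym x) px.
by rewrite (_ : _ == x = false) //; apply: contraNF px => /eqP px; rewrite -{2}p3 px.
Qed.

Lemma face_permE (M : cmap) d : face_perm M d = rotation M (rev_dart d).
Proof. by rewrite permM permE. Qed.

Lemma face_perm_dual (M : cmap) : face_perm (dual_map M) = rotation M.
Proof.
apply/permP => d; rewrite face_permE /= face_permE; congr (rotation M _).
by case: d => e b; rewrite /rev_dart /= negbK.
Qed.

Lemma vol_lozenge_dual (R : realType) (M : cmap) k : regular M k ->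
  vol_lozenge R (dual_map M) = #|{: vertex M}|%:R * vol_bipyramid R k.
Proof.
move=> Mk; rewrite /vol_lozenge /faces face_perm_dual.
rewrite (eq_bigr (fun=> vol_bipyramid R k)) => [|v vV].
  by rewrite sumr_const mulr_natl card_sig; congr (_ *+ _); apply: eq_card => x; rewrite inE.
by have /= -> := Mk (exist _ v vV).
Qed.

Section TruncationFaces.
Variables (R : realType) (G : lattice_graph).
Hypothesis G3 : regular G 3.
Local Notation dart := (medge G * bool)%type.
Local Notation T := (truncation G).
Local Notation rot := (rotation G).
Local Notation phi := (face_perm G).
Local Notation Phi := (face_perm T).

Let Phi_old e b : Phi (inl e, b) = (inr (e, ~~ b), false).
Proof. by rewrite face_permE permE. Qed.

Let Phi_fwd d : Phi (inr d, false) = (inl (rot d).1, (rot d).2).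
Proof. by rewrite face_permE permE. Qed.

Let Phi_bwd d : Phi (inr d, true) = (inr (rot^-1 d)%g, true).
Proof. by rewrite face_permE permE. Qed.

Let old (d : dart) : medge T * bool := (inl d.1, d.2).
Let fwd (d : dart) : medge T * bool := (inr (rev_dart d), false).
Let bwd (d : dart) : medge T * bool := (inr d, true).

Let Phi2 d : Phi (Phi (old d)) = old (phi d).
Proof. by case: d => e b; rewrite Phi_old Phi_fwd face_permE. Qed.

(** Around such a face, old darts alternate with forward sides, and two steps of [Phi] lift one step
    of [phi]. *)
Lemma card_porbit_old d : #|porbit Phi (old d)| = (2 * #|porbit phi d|)%N.
Proof.
have old_inj : injective old by move=> [? ?] [? ?] [-> ->].
have fwd_inj : injective fwd.
  by move=> [e b] [e' b'] [-> /(can_inj negbK) ->].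
have -> : porbit Phi (old d) = old @: porbit phi d :|: fwd @: porbit phi d.
  apply/eqP; rewrite finset.eqEsubset; apply/andP; split.
    apply: porbit_subset; first by rewrite inE imset_f // porbit_id.
    move=> y; rewrite !inE => /orP[] /imsetP[z zd ->].
      apply/orP; right; apply/imsetP; exists z => //.
      by case: z {zd} => e b; rewrite Phi_old.
    apply/orP; left; apply/imsetP; exists (phi z).
      by rewrite -eq_porbit_mem porbit_perm eq_porbit_mem.
    by case: z {zd} => e b; rewrite /fwd Phi_fwd face_permE.
  have H i : old ((phi ^+ i)%g d) \in porbit Phi (old d).
    elim: i => [|i IH]; first by rewrite expg0 perm1 porbit_id.
    rewrite expgSr permM -Phi2 -eq_porbit_mem !porbit_perm eq_porbit_mem.
    exact: IH.
  apply/fintype.subsetP => x; rewrite inE => /orP[] /imsetP[y /porbitP[i ->] ->]; first exact: H.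
  have -> : fwd ((phi ^+ i)%g d) = Phi (old ((phi ^+ i)%g d)).
    by case: ((phi ^+ i)%g d) => e b; rewrite Phi_old.
  by rewrite -eq_porbit_mem porbit_perm eq_porbit_mem.
rewrite cardsU (_ : _ :&: _ = finset.set0) ?cards0 ?subn0.
  by rewrite !card_imset // mul2n addnn.
apply/setP => x; rewrite !inE; apply/negP => /andP[/imsetP[y _ ->] /imsetP[z _]].
by [].
Qed.

Lemma card_porbit_fwd d : #|porbit Phi (inr d, false)| = (2 * #|porbit phi (rot d)|)%N.
Proof. by rewrite -porbit_perm Phi_fwd card_porbit_old. Qed.

Lemma card_porbit_bwd d : #|porbit Phi (inr d, true)| = 3.
Proof.
have bwd_inj : injective bwd by move=> ? ? [].
rewrite -[RHS](G3 (vertex_of d)) /= -(porbitV rot) -(card_imset _ bwd_inj).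
congr #|pred_of_set _|; apply/eqP; rewrite finset.eqEsubset; apply/andP; split.
  apply: porbit_subset; first by rewrite imset_f // porbit_id.
  move=> _ /imsetP[z zd ->]; rewrite {1}/bwd Phi_bwd.
  apply/imsetP; exists (rot^-1 z)%g => //.
  by move: zd; rewrite -!eq_porbit_mem porbit_perm.
apply/fintype.subsetP => _ /imsetP[_ /porbitP[i ->] ->].
elim: i => [|i IH]; first by rewrite expg0 perm1 porbit_id.
by rewrite expgSr permM /bwd -Phi_bwd -eq_porbit_mem porbit_perm eq_porbit_mem.
Qed.

Lemma regular_truncation : regular T 3.
Proof.
move=> y; have [d <-] := corner_surj y.
apply: card_porbit3; rewrite !permE //=.
by rewrite permKV -!surjective_pairing.
Qed.

Lemma vol_lozenge_truncation : vol_lozenge R T =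
  (\sum_(f in faces G) vol_bipyramid R (2 * #|f|)) + #|{: vertex G}|%:R * vol_bipyramid R 3.
Proof.
rewrite /vol_lozenge /faces (sum_porbits _ (vol_bipyramid R)).
rewrite (sum_porbits phi (fun k => vol_bipyramid R (2 * k))).
pose g k := vol_bipyramid R (2 * k) / (2 * k)%:R.
pose F x := vol_bipyramid R #|porbit Phi x| / #|porbit Phi x|%:R.
transitivity (\sum_i \sum_b F (i, b)); first by rewrite pair_bigA; apply: eq_bigr => -[].
rewrite big_sumType /=.
have -> : \sum_e \sum_b F (inl e, b) = \sum_d g #|porbit phi d|.
  rewrite pair_bigA; apply: eq_bigr => -[e b] _.
  by rewrite /F (card_porbit_old (e, b)).
have -> : \sum_d \sum_b F (inr d, b) =
    \sum_d g #|porbit phi d| + \sum_(d : dart) vol_bipyramid R 3 / 3.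
  rewrite [X in _ = X + _](reindex_inj (@perm_inj _ rot)) -big_split /=.
  by apply: eq_bigr => d _; rewrite big_bool /F card_porbit_fwd card_porbit_bwd addrC.
(* A dart d counts once as an old dart and once through a forward side, and 2 / (2 k) = 1 / k. The
   backward sides run around the triangles. *)
rewrite addrA -big_split sumr_const /=; congr (_ + _).
  apply: eq_bigr => d _; rewrite /g natrM.
  have k0 : #|porbit phi d|%:R != 0 :> R.
    by rewrite pnatr_eq0 -lt0n; apply/card_gt0P; exists d; exact: porbit_id.
  by field.
have cD : #|{: dart}| = (3 * #|{: vertex G}|)%N.
  by rewrite (cubic_card G3) card_prod card_bool mulnC.
rewrite -[_ *+ _]mulr_natr cD natrM.
by field.
Qed.

End TruncationFaces.

Import numFieldNormedType.Exports.
Local Open Scope classical_set_scope.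
Local Open Scope ring_scope.

(** * The Lobachevsky function *)

Lemma within_continuous_comp_sub (U V W : topologicalType) (A : set U) (B : set V)
    (f : U -> V) (g : V -> W) : (forall x, A x -> B (f x)) ->
  {within A, continuous f} -> {within B, continuous g} -> {within A, continuous (g \o f)}.
Proof.
move=> AB /subspace_continuousP cf /subspace_continuousP cg.
apply/subspace_continuousP => x Ax.
apply: (@cvg_comp _ _ _ f g _ (within B (nbhs (f x)))); last exact: cg (AB _ Ax).
move=> P; rewrite /within /= => nP.
have := cf x Ax _ nP; rewrite /nbhs /= /within /=.
by apply: filterS => y H Ay; apply: (H Ay); exact: AB.
Qed.

Section Integrability.
Variable R : realType.
Local Notation mu := (@lebesgue_measure R).

(** The mean value theorem is applied to F minus the indefinite integral of f, whose derivative F' -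
    f is nonnegative. *)
Lemma integral_le_primitive (f F F' : R -> R) (a b : R) : a < b ->
  {within `[a, b], continuous f} ->
  (forall x, x \in `[a, b] -> is_derive x 1 F (F' x) /\ f x <= F' x) ->
  \int[mu]_(x in `[a, b]) f x <= F b - F a.
Proof.
move=> ab cf dF; pose H x := F x - \int[mu]_(t in `[a, x]) f t.
have fi : mu.-integrable `[a, b] (EFin \o f).
  by apply: continuous_compact_integrable => //; exact: segment_compact.
have dH x : x \in `]a, b[ -> is_derive x 1 H (F' x - f x).
  move=> xab; have [dFx _] := dF x (subset_itv_oo_cc xab).
  move: (xab); rewrite in_itv /= => /andP[ax xb].
  have [d1 d2] := continuous_FTC1_closed xb fi ax (within_continuous_continuous ab cf xab).
  have dI : is_derive x 1 (fun x => \int[mu]_(t in `[a, x]) f t) (f x).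
    by apply: DeriveDef; [exact: d1|rewrite -derive1E; exact: d2].
  exact: is_deriveB.
have cH : {within `[a, b], continuous H}.
  apply: within_continuousB; last exact: parameterized_integral_continuous (ltW ab) fi.
  apply: derivable_within_continuous => x /dF[dFx _]; exact: ex_derive.
have [c cab] := MVT ab dH cH.
rewrite /H set_itv1 Rintegral_set1 subr0 => e.
have [_ fF] := dF c (subset_itv_oo_cc cab).
have : 0 <= (F' c - f c) * (b - a) by rewrite mulr_ge0 ?subr_ge0 // ltW.
by rewrite -e; lra.
Qed.

(** Monotone convergence along increasing segments, meant for an integrand singular at both ends of
    an interval. *)
Lemma ge0_integrable_primitive (f F F' : R -> R) (u v : R^nat) (M : R) :
  nonincreasing_seq u -> nondecreasing_seq v -> (forall n, u n < v n) ->
  (forall n x, x \in `[u n, v n] ->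
     [/\ {for x, continuous f}, is_derive x 1 F (F' x) & 0 <= f x <= F' x]) ->
  (forall n, F (v n) - F (u n) <= M) ->
  mu.-integrable (\bigcup_n `[u n, v n]%classic) (EFin \o f).
Proof.
move=> ud vi uv H FM.
have cf n : {within `[u n, v n], continuous f}.
  by apply: continuous_in_subspaceT => x; rewrite inE => /H[].
have mf n : measurable_fun `[u n, v n]%classic f.
  by apply: subspace_continuous_measurable_fun => //; exact: cf.
have mU : measurable (\bigcup_n `[u n, v n]%classic) by exact: bigcup_measurable.
have f0 n x : `[u n, v n]%classic x -> (0 <= (EFin \o f) x)%E.
  by move=> /H[_ _ /andP[? _]]; rewrite lee_fin.
have nd : nondecreasing_seq (fun n => `[u n, v n]%classic : set R).
  move=> m n mn; apply/subsetPset => x; rewrite /= !in_itv /= => /andP[h1 h2].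
  by rewrite (le_trans (ud _ _ mn)) // (le_trans h2) // vi.
apply/integrableP; split.
  by apply/measurable_EFinP/measurable_fun_bigcup.
have -> : (\int[mu]_(x in \bigcup_n `[u n, v n]%classic) `|(EFin \o f) x| =
    \int[mu]_(x in \bigcup_n `[u n, v n]%classic) (EFin \o f) x)%E.
  apply: eq_integral => x; rewrite inE => -[n _ xn].
  by rewrite gee0_abs // (f0 n).
have cv : (\int[mu]_(x in `[u i, v i]) (EFin \o f) x @[i --> \oo]
    --> \int[mu]_(x in \bigcup_n `[u n, v n]%classic) (EFin \o f) x)%E.
  apply: ge0_nondecreasing_set_cvg_integral => // n.
  by apply/measurable_EFinP; exact: mf.
apply: (@le_lt_trans _ _ M%:E); last exact: ltry.
rewrite -(cvg_lim _ cv) //; apply: lime_le; first exact: cvgP cv.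
near=> n.
have fi : mu.-integrable `[u n, v n]%classic (EFin \o f).
  by apply: continuous_compact_integrable; [exact: segment_compact|exact: cf].
rewrite -[leLHS]fineK ?lee_fin; last exact: integrable_fin_num.
apply: le_trans (FM n); apply: (@integral_le_primitive f F F') => // x /H[_ ? /andP[]] //.
Unshelve. all: by end_near. Qed.
End Integrability.

Section PointwiseDerivatives.
Variable R : realType.
Implicit Types (f g : R -> R) (x a b c : R).

Lemma deriveD_pt f g x a b : is_derive x 1 f a -> is_derive x 1 g b ->
  is_derive x 1 (fun y => f y + g y) (a + b).
Proof. by move=> df dg; apply: is_deriveD. Qed.

Lemma deriveB_pt f g x a b : is_derive x 1 f a -> is_derive x 1 g b ->
  is_derive x 1 (fun y => f y - g y) (a - b).
Proof. by move=> df dg; apply: is_deriveB. Qed.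

Lemma deriveM_pt f g x a b : is_derive x 1 f a -> is_derive x 1 g b ->
  is_derive x 1 (fun y => f y * g y) (a * g x + f x * b).
Proof.
move=> df dg; apply: is_derive_eq; rewrite /GRing.scale /=; ring.
Qed.

Lemma deriveN_pt f x a : is_derive x 1 f a -> is_derive x 1 (fun y => - f y) (- a).
Proof. by move=> df; apply: is_deriveN. Qed.

Lemma deriveZ_pt c f x a : is_derive x 1 f a -> is_derive x 1 (fun y => c * f y) (c * a).
Proof. by move=> df; apply: is_deriveZ. Qed.

Lemma derive_cst_pt c x : is_derive x 1 (fun=> c : R) 0.
Proof. exact: is_derive_cst. Qed.

Lemma derive_id_pt x : is_derive x 1 (fun y : R => y) 1.
Proof. exact: is_derive_id. Qed.

Lemma derive_comp_pt f g x a b : is_derive (g x) 1 f a -> is_derive x 1 g b ->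
  is_derive x 1 (fun y => f (g y)) (a * b).
Proof. by move=> df dg; apply: is_derive1_comp. Qed.

Lemma derive_continuous f x a : is_derive x 1 f a -> {for x, continuous f}.
Proof. by move=> [d _]; apply/differentiable_continuous/derivable1_diffP. Qed.

Lemma derive_sub_pt f c x a : is_derive (c - x) 1 f a ->
  is_derive x 1 (fun y => f (c - y)) (- a).
Proof.
move=> df; rewrite -mulrN1; apply: (@derive_comp_pt f (fun y => c - y)) => //.
by have := deriveB_pt (derive_cst_pt c x) (derive_id_pt x); rewrite add0r.
Qed.

Lemma derive_scale_pt f c x a : is_derive (c * x) 1 f a ->
  is_derive x 1 (fun y => f (c * y)) (c * a).
Proof.
move=> df; rewrite mulrC; apply: (@derive_comp_pt f (fun y => c * y)) => //.
by have := deriveZ_pt c (derive_id_pt x); rewrite mulr1.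
Qed.

Lemma derive_ge0_le f (df : R -> R) a b : a <= b ->
  (forall x, x \in `]a, b[ -> is_derive x 1 f (df x)) ->
  (forall x, x \in `]a, b[ -> 0 <= df x) ->
  {within `[a, b], continuous f} -> f a <= f b.
Proof.
rewrite le_eqVlt => /predU1P[->//|ab] dF df0 cf.
have [c cab e] := MVT ab dF cf; rewrite -subr_ge0 e mulr_ge0 ?df0 ?subr_ge0 //.
exact: ltW.
Qed.

Lemma derive0_eq f (df : R -> R) a b : a <= b ->
  (forall x, x \in `]a, b[ -> is_derive x 1 f (df x)) ->
  (forall x, x \in `]a, b[ -> df x = 0) ->
  {within `[a, b], continuous f} -> f a = f b.
Proof.
rewrite le_eqVlt => /predU1P[->//|ab] dF df0 cf.
have [c cab e] := MVT ab dF cf; apply/eqP; rewrite eq_sym -subr_eq0 e df0 //.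
by rewrite mul0r.
Qed.

Lemma cos_pos x : 0 <= x < pi / 2 -> 0 < cos x.
Proof.
move=> /andP[x0 xp]; apply: cos_gt0_pihalf; rewrite xp andbT.
by have := @pi_gt0 R; lra.
Qed.

Lemma x_cos_le_sin x : 0 <= x <= pi -> x * cos x <= sin x.
Proof.
move=> /andP[x0 xpi]; pose f (y : R) := sin y - y * cos y.
have d (y : R) : is_derive y 1 f (y * sin y).
  have := deriveB_pt (is_derive_sin y) (deriveM_pt (derive_id_pt y) (is_derive_cos y)).
  by move=> /is_derive_eq; apply; ring.
have : f 0 <= f x.
  apply: (@derive_ge0_le _ (fun y => y * sin y)) => //.
    move=> y; rewrite in_itv /= => /andP[y0 yx].
    by rewrite mulr_ge0 ?ltW // sin_gt0_pi // y0 (lt_le_trans yx).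
  by apply: continuous_subspaceT => y; exact: derive_continuous (d y).
by rewrite /f sin0 mul0r subrr subr_ge0.
Qed.

End PointwiseDerivatives.

Section LnSin.
Variable R : realType.
Local Notation mu := (@lebesgue_measure R).
(** Its derivative is - ln (sin s) + (1 - s cot s), and s cot s <= 1 on ]0, pi / 2]: there A'
    dominates - ln (sin s), while A stays between 0 and pi / 2. *)
Let A (s : R) : R := s - s * ln (sin s).
Let A' (s : R) : R := 1 - ln (sin s) - s * cos s / sin s.

Let dA s : 0 < s < pi -> is_derive s 1 A (A' s).
Proof.
move=> s0; have := sin_gt0_pi s0 => ss.
have dl : is_derive s 1 (fun y => ln (sin y)) ((sin s)^-1 * cos s).
  exact: derive_comp_pt (is_derive1_ln ss) (is_derive_sin s).
have := deriveB_pt (derive_id_pt s) (deriveM_pt (derive_id_pt s) dl).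
by move=> /is_derive_eq; apply; rewrite /A'; field; rewrite gt_eqF.
Qed.

Let A'ge s : 0 < s <= pi / 2 -> - ln (sin s) <= A' s.
Proof.
move=> /andP[s0 sp]; have pp := @pi_gt0 R.
have ss : 0 < sin s by apply: sin_gt0_pi; lra.
have : s * cos s / sin s <= 1.
  by rewrite ler_pdivrMr // mul1r; apply: x_cos_le_sin; lra.
by rewrite /A'; lra.
Qed.

Let ln_sin_le0 s : ln (sin s) <= 0 :> R.
Proof. by apply: ln_le0; exact: sin_le1. Qed.

Let A0 s : 0 <= s -> 0 <= A s.
Proof. by move=> s0; rewrite /A; have := ln_sin_le0 s; nra. Qed.

Let Apihalf s : 0 < s <= pi / 2 -> A s <= pi / 2.
Proof.
move=> /andP[s0 sp]; have pp := @pi_gt0 R.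
have -> : pi / 2 = A (pi / 2) by rewrite /A sin_pihalf ln1 mulr0 subr0.
apply: (@derive_ge0_le _ A A' s (pi / 2) sp).
- move=> y; rewrite in_itv /= => /andP[y1 y2]; apply: dA; lra.
- move=> y; rewrite in_itv /= => /andP[y1 y2]; apply: le_trans (A'ge _); last lra.
  by rewrite oppr_ge0.
- apply: derivable_within_continuous => y; rewrite in_itv /= => /andP[y1 y2].
  by apply: ex_derive; apply: dA; lra.
Qed.

Lemma integrable_ln_sin : mu.-integrable `[0, pi] (fun x => (ln (sin x))%:E).
Proof.
have pp := @pi_gt0 R.
(* The index shift by 2 gives u n <= pi / 4, so the segments are nondegenerate from n = 0 on. *)
pose u (n : nat) : R := (pi / 2) / n.+2%:R; pose v n := pi - u n.
have n2 (n : nat) : (2 : R) <= n.+2%:R by rewrite ler_nat.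
have ln2_ge0 : 0 <= ln 2 :> R by apply: ln_ge0; lra.
have n20 (n : nat) : (0 : R) < n.+2%:R by rewrite ltr0n.
have u0 n : 0 < u n by rewrite /u divr_gt0 // divr_gt0.
have u4 n : u n <= pi / 4.
  by rewrite /u ler_pdivrMr //; have := n2 n; nra.
have ud : nonincreasing_seq u.
  move=> m n mn; rewrite /u ler_pM2l ?divr_gt0 // lef_pV2 ?posrE //.
  by rewrite ler_nat.
have U : \bigcup_n `[u n, v n]%classic = `]0, pi[%classic :> set R.
  apply/seteqP; split=> x.
    move=> [n _] /=; rewrite !in_itv /= /v => /andP[h1 h2].
    by have := u0 n; move: h1 h2; lra.
  rewrite /= in_itv /= => /andP[x0 xp].
  pose e := Num.min x (pi - x); have e0 : 0 < e by rewrite lt_min x0 subr_gt0.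
  have [n ne] : exists n : nat, u n <= e.
    exists (Num.truncn ((pi / 2) / e)); rewrite /u ler_pdivrMr // [e * _]mulrC -ler_pdivrMr //.
    have := truncnS_gt ((pi / 2) / e); move=> /ltW/le_trans; apply.
    by rewrite ler_nat.
  exists n => //=; rewrite in_itv /= /v; move: ne; rewrite /e le_min => /andP[h1 h2].
  lra.
(* As sin t = 2 sin (t / 2) cos (t / 2), the derivative of F dominates
   - ln (sin t), while F stays bounded at both ends of ]0, pi[. *)
pose F (t : R) := 2 * A (2^-1 * t) - 2 * A (2^-1 * (pi - t)).
pose F' (t : R) := A' (2^-1 * t) + A' (2^-1 * (pi - t)).
have main : mu.-integrable (\bigcup_n `[u n, v n]%classic) (EFin \o (fun x : R => - ln (sin x))).
  (* The increment of F is 4 A ((pi - u n) / 2) - 4 A (u n / 2), at most 4 (pi / 2). *)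
  apply: (@ge0_integrable_primitive R _ F F' u v (2 * pi)).
  - exact: ud.
  - by move=> m n mn; rewrite /v lerD2l lerN2 ud.
  - by move=> n; rewrite /v; have := u4 n; lra.
  - move=> n x; rewrite in_itv /= /v => /andP[x1 x2].
    have x0 : 0 < x by have := u0 n; lra.
    have xp : x < pi by have := u0 n; lra.
    have sx : 0 < sin x by apply: sin_gt0_pi; rewrite x0 xp.
    have s2 : 0 < sin (2^-1 * x) by apply: sin_gt0_pi; lra.
    have c2 : 0 < cos (2^-1 * x) by apply: cos_pos; lra.
    have sE : sin x = 2 * (sin (2^-1 * x) * cos (2^-1 * x)).
      have {1}-> : x = (2^-1 * x) *+ 2 by rewrite mulr2n; lra.
      by rewrite sin_mulr2n mulr2n; ring.
    have cE : sin (2^-1 * (pi - x)) = cos (2^-1 * x).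
      by rewrite mulrBr mulrC sinB sin_pihalf cos_pihalf mul1r mul0r subr0.
    split.
    + apply: derive_continuous; apply: deriveN_pt.
      exact: derive_comp_pt (is_derive1_ln sx) (is_derive_sin x).
    + have d1 : is_derive x 1 (fun t => A (2^-1 * t)) (2^-1 * A' (2^-1 * x)).
        by apply: derive_scale_pt; apply: dA; lra.
      have d2 : is_derive x 1 (fun t => A (2^-1 * (pi - t))) (- (2^-1 * A' (2^-1 * (pi - x)))).
        apply: (@derive_sub_pt _ (fun z => A (2^-1 * z))); apply: derive_scale_pt.
        by apply: dA; lra.
      have dd := deriveB_pt (deriveZ_pt 2 d1) (deriveZ_pt 2 d2).
      have -> : F' x = 2 * (2^-1 * A' (2^-1 * x)) - 2 * - (2^-1 * A' (2^-1 * (pi - x))).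
        by rewrite /F'; field.
      exact: dd.
    + rewrite oppr_ge0 ln_sin_le0 /=.
      have h1 := @A'ge (2^-1 * x); have h2 := @A'ge (2^-1 * (pi - x)).
      apply: (@le_trans _ _ (- ln (sin (2^-1 * x)) - ln (cos (2^-1 * x)))).
        rewrite sE lnM ?posrE ?mulr_gt0 // lnM ?posrE //.
        by rewrite lerNl opprD opprK; move: ln2_ge0; lra.
      rewrite /F' -cE; apply: lerD; [apply: h1|apply: h2]; lra.
  - move=> n; rewrite /F /v.
    have -> : 2^-1 * (pi - (pi - u n)) = 2^-1 * u n by ring.
    have h1 : 0 <= A (2^-1 * u n) by apply: A0; have := u0 n; lra.
    have h2 : A (2^-1 * (pi - u n)) <= pi / 2 by apply: Apihalf; have := u0 n; have := u4 n; lra.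
    lra.
have {}main : mu.-integrable `]0, pi[%classic (fun x => (ln (sin x))%:E).
  move: main; rewrite U => /integrableN.
  apply: eq_integrable; first exact: measurable_itv.
  by move=> x _; rewrite /= opprK.
have [mf _] := integrableP _ _ _ main.
have mf0 : measurable_fun `[0, pi]%classic (fun x : R => (ln (sin x))%:E).
  apply/measurable_EFinP; apply: measurable_funTS.
  apply: measurableT_comp; first exact: measurable_ln.
  by apply: continuous_measurable_fun; exact: continuous_sin.
apply/integrableP; split=> //.
rewrite integral_itv_bndoo; first by have [] := integrableP _ _ _ main.
exact: measurableT_comp mf.
Qed.

End LnSin.

(** * Sine and cosine at special angles, and a lower bound for pi *)

Section SpecialAngles.
Variable R : realType.

(** At x = pi / 6 one has 0 = cos (3 x) = cos x (1 - 2 sin x) (1 + 2 sin x). *)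
Lemma sin_pi6 : sin (pi / 6) = 1 / 2 :> R.
Proof.
have pp := @pi_gt0 R.
set x : R := pi / 6; have s0 : 0 < sin x by apply: sin_gt0_pi; rewrite /x; lra.
have c0 : 0 < cos x by apply: cos_pos; rewrite /x; lra.
have h : cos (x *+ 2 + x) = 0 by rewrite -cos_pihalf; congr cos; rewrite /x mulr2n; lra.
rewrite cosD cos_mulr2n sin_mulr2n !mulr2n cos2sin2 in h.
have : cos x * ((1 - 2 * sin x) * (1 + 2 * sin x)) = 0 by rewrite -[RHS]h; ring.
by move=> /eqP; rewrite !mulf_eq0 gt_eqF //= => /orP[]/eqP h1; lra.
Qed.

Lemma cos_pi6_sqr : cos (pi / 6) ^+ 2 = 3 / 4 :> R.
Proof.
have := cos2Dsin2 (pi / 6 : R).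
by rewrite sin_pi6 (_ : (1 / 2) ^+ 2 = 1 / 4); [lra|field].
Qed.

Lemma sin_pi4_sqr : sin (pi / 4) ^+ 2 = 1 / 2 :> R.
Proof.
have h := @cos_pihalf R; rewrite (_ : pi / 2 = (pi / 4) *+ 2) in h; last by rewrite -mulr_natr; lra.
by rewrite cos_mulr2n -mulr_natr in h; have := cos2Dsin2 (pi / 4 : R); lra.
Qed.

Lemma sin_le_id (x : R) : 0 <= x -> sin x <= x.
Proof.
move=> x0; pose f (y : R) := y - sin y.
have d (y : R) : is_derive y 1 f (1 - cos y).
  exact: deriveB_pt (derive_id_pt y) (is_derive_sin y).
have : f 0 <= f x.
  apply: (@derive_ge0_le _ f (fun y => 1 - cos y) 0 x x0 (fun y _ => d y)).
    by move=> y _; rewrite subr_ge0 cos_le1.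
  by apply: continuous_subspaceT => y; exact: derive_continuous (d y).
by rewrite /f sin0 subrr subr_ge0.
Qed.

Lemma cos_ge_quadratic (x : R) : 0 <= x -> 1 - x ^+ 2 / 2 <= cos x.
Proof.
move=> x0; pose f (y : R) := cos y + 2^-1 * (y * y).
have d (y : R) : is_derive y 1 f (y - sin y).
  have := deriveD_pt (is_derive_cos y) (deriveZ_pt 2^-1 (deriveM_pt (derive_id_pt y) (derive_id_pt y))).
  by move=> /is_derive_eq; apply; field.
have : f 0 <= f x.
  apply: (@derive_ge0_le _ f (fun y => y - sin y) 0 x x0 (fun y _ => d y)).
  - by move=> y; rewrite in_itv /= => /andP[y0 _]; rewrite subr_ge0 sin_le_id // ltW.
  - by apply: continuous_subspaceT => y; exact: derive_continuous (d y).
by rewrite /f cos0 !mulr0 expr2; lra.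
Qed.

(** The quadratic bound for the cosine at pi / 6, where 0.8661 is just above sqrt 3 / 2, would even
    give 3.10. The value 3.07 is what [vol_bipyramid3_lt] consumes. *)
Lemma pi_gt307 : 307 / 100 < pi :> R.
Proof.
have pp := @pi_gt0 R.
have c1 : cos (pi / 6) <= 8661 / 10000 :> R.
  by have := cos_pi6_sqr; rewrite expr2; nra.
have := @cos_ge_quadratic (pi / 6); rewrite expr2.
have h : 0 <= pi / 6 :> R by lra.
by move=> /(_ h); nra.
Qed.

Lemma sin_mono (x y : R) : 0 <= x -> x <= y -> y <= pi / 2 -> sin x <= sin y.
Proof.
have pp := @pi_gt0 R.
move=> x0 xy yp; apply: (@derive_ge0_le _ sin cos x y xy (fun z _ => is_derive_sin z)).
- by move=> z; rewrite in_itv /= => /andP[? ?]; apply/ltW/cos_pos; lra.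
- exact/continuous_subspaceT/continuous_sin.
Qed.

End SpecialAngles.

Section Lobachevsky.
Variable R : realType.
Local Notation mu := (@lebesgue_measure R).
Local Notation L := (@lobachevsky R).
Lemma integrable_ln_2sin : mu.-integrable `[0, pi] (fun t => (ln `|2 * sin t|)%:E).
Proof.
have mf : measurable_fun [set: R] (fun t => ln `|2 * sin t|).
  apply: measurableT_comp; first exact: measurable_ln.
  apply: measurableT_comp; first exact: normr_measurable.
  by apply: measurable_funM => //; apply: continuous_measurable_fun; exact: continuous_sin.
have i0 : mu.-integrable `]0, pi[%classic (fun t => (ln `|2 * sin t|)%:E).
  have i1 : mu.-integrable `]0, pi[%classic (fun x => (ln (sin x))%:E).
    apply: integrableS (integrable_ln_sin R) => //.
    exact: subset_itv_oo_cc.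
  have i2 : mu.-integrable `]0, pi[%classic (cst (ln 2)%:E).
    apply: integrableS (_ : mu.-integrable `[0, pi] _) => //; first exact: subset_itv_oo_cc.
    apply: (@continuous_compact_integrable _ (cst (ln 2))); first exact: segment_compact.
    by apply: continuous_subspaceT => x; exact: cvg_cst.
  apply: eq_integrable (integrableD _ i2 i1) => // x; rewrite inE /= in_itv /= => x0.
  have sx := sin_gt0_pi x0.
  by rewrite -EFinD ger0_norm ?mulr_ge0 ?ltW // lnM ?posrE.
apply/integrableP; split.
  by apply/measurable_EFinP; exact: measurable_funTS mf.
rewrite integral_itv_bndoo; first by have [] := integrableP _ _ _ i0.
by have [m _] := integrableP _ _ _ i0; exact: measurableT_comp m.
Qed.

Lemma lobachevsky0 : L 0 = 0.
Proof.
have pp := @pi_gt0 R.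
by rewrite /lobachevsky set_itv1 Rintegral_set1 oppr0. Qed.

Lemma lobachevsky_continuous : {within `[0, pi], continuous L}.
Proof.
have pp := @pi_gt0 R.
have := parameterized_integral_continuous (ltW pp) integrable_ln_2sin.
by move=> h x; apply: cvgN; exact: h.
Qed.

Lemma lobachevsky_derive x : 0 < x < pi -> is_derive x 1 L (- ln (2 * sin x)).
Proof.
move=> x0; have [x1 x2] := andP x0; have sx := sin_gt0_pi x0.
have s2 : 0 < `|2 * sin x| by rewrite normr_gt0 mulf_neq0 // gt_eqF.
have cf : {for x, continuous (fun t : R => ln `|2 * sin t|)}.
  apply: (@continuous_comp _ _ _ (fun t : R => `|2 * sin t|) (@ln R)).
    apply: (@continuous_comp _ _ _ (fun t : R => 2 * sin t) (@Num.norm _ R)).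
      exact: derive_continuous (deriveZ_pt 2 (is_derive_sin x)).
    exact: norm_continuous.
  exact: continuous_ln.
have [d1 d2] := continuous_FTC1_closed x2 integrable_ln_2sin x1 cf.
have dI : is_derive x 1 (fun x => \int[mu]_(t in `[0, x]) (ln `|2 * sin t|)) (ln (2 * sin x)).
  apply: DeriveDef; first exact: d1.
  by rewrite -derive1E d2 ger0_norm // mulr_ge0 // ltW.
exact: deriveN_pt dI.
Qed.

(** Estimates are made on the complementary angle: the derivative ln (2 cos t) is regular at 0, and
    psi vanishes there. *)
Let psi (t : R) := L (pi / 2 - t).

Let psi_derive t : 0 <= t < pi / 2 -> is_derive t 1 psi (ln (2 * cos t)).
Proof.
have pp := @pi_gt0 R.
move=> t0; have h : 0 < pi / 2 - t < pi by lra.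
have := derive_sub_pt (lobachevsky_derive h); rewrite opprK.
by rewrite sinB sin_pihalf cos_pihalf mul1r mul0r subr0.
Qed.

Let psi_continuous a b : 0 <= a -> b <= pi / 2 -> {within `[a, b], continuous psi}.
Proof.
have pp := @pi_gt0 R.
move=> a0 bp; apply: (@within_continuous_comp_sub _ _ _ _ `[0, pi]%classic (fun t => pi / 2 - t) L).
- by move=> x /=; rewrite !in_itv /= => /andP[? ?]; lra.
- apply: continuous_subspaceT => x.
  exact: derive_continuous (deriveB_pt (derive_cst_pt (pi / 2) x) (derive_id_pt x)).
- exact: lobachevsky_continuous.
Qed.

(** Its derivative is 0 because sin (2 x) = 2 sin x cos x; its constancy is the duplication formula
    up to the value [D 0]. *)
Let D (t : R) := L (2 * t) - 2 * L t + 2 * psi t.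

Let D_cst t : 0 <= t <= pi / 2 -> D 0 = D t.
Proof.
have pp := @pi_gt0 R.
move=> /andP[t0 tp].
pose dD (x : R) := 2 * (- ln (2 * sin (2 * x))) - 2 * (- ln (2 * sin x)) + 2 * ln (2 * cos x).
apply: (@derive0_eq _ D dD 0 t t0) => [x|x|].
- rewrite in_itv /= => /andP[x0 xt].
  have d1 : is_derive x 1 (fun y => L (2 * y)) (2 * (- ln (2 * sin (2 * x)))).
    by apply: derive_scale_pt; apply: lobachevsky_derive; lra.
  have d2 : is_derive x 1 L (- ln (2 * sin x)) by apply: lobachevsky_derive; lra.
  have d3 : is_derive x 1 psi (ln (2 * cos x)) by apply: psi_derive; lra.
  exact: deriveD_pt (deriveB_pt d1 (deriveZ_pt 2 d2)) (deriveZ_pt 2 d3).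
- rewrite in_itv /= => /andP[x0 xt]; rewrite /dD.
  have s0 : 0 < sin x by apply: sin_gt0_pi; lra.
  have c0 : 0 < cos x by apply: cos_pos; lra.
  have -> : 2 * sin (2 * x) = (2 * sin x) * (2 * cos x).
    have -> : 2 * x = x *+ 2 by rewrite mulr2n; lra.
    by rewrite sin_mulr2n mulr2n; ring.
  by rewrite lnM ?posrE ?mulr_gt0 //; ring.
- have c1 : {within `[0, t], continuous (fun y => L (2 * y))}.
    have := @within_continuous_comp_sub R R R `[0, t]%classic `[0, pi]%classic (fun y => 2 * y) L.
    apply.
    + by move=> x /=; rewrite !in_itv /= => /andP[? ?]; lra.
    + apply: continuous_subspaceT => x.
      exact: derive_continuous (deriveZ_pt 2 (derive_id_pt x)).
    + exact: lobachevsky_continuous.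
  have c2 : {within `[0, t], continuous (fun y => 2 * L y)}.
    have : {within `[0, t], continuous L}.
      apply: continuous_subspaceW lobachevsky_continuous.
      by apply: subset_itvl; rewrite bnd_simp; lra.
    by move=> h x; apply: cvgM; [exact: cvg_cst|exact: h].
  have c3 : {within `[0, t], continuous (fun y => 2 * psi y)}.
    by move=> x; apply: cvgM; [exact: cvg_cst|exact: psi_continuous].
  by move=> x; apply: cvgD; [apply: cvgB; [exact: c1|exact: c2]|exact: c3].
Qed.

(** D equals 2 L(pi / 2) at 0, and L(pi / 2) at pi / 4, where the two other terms cancel. *)
Lemma lobachevsky_pihalf : L (pi / 2) = 0.
Proof.
have pp := @pi_gt0 R.
have := @D_cst (pi / 4); rewrite /D /psi mulr0 subr0 lobachevsky0.
have -> : 2 * (pi / 4) = pi / 2 :> R by lra.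
have -> : pi / 2 - pi / 4 = pi / 4 :> R by lra.
by move=> h; have := h ltac:(lra); lra.
Qed.

Lemma lobachevsky_dup t : 0 <= t <= pi / 2 -> L (2 * t) = 2 * L t - 2 * L (pi / 2 - t).
Proof.
have pp := @pi_gt0 R.
move=> /D_cst; rewrite /D /psi mulr0 subr0 lobachevsky0 lobachevsky_pihalf; lra.
Qed.

Lemma lobachevsky_pi : L pi = 0.
Proof.
have pp := @pi_gt0 R.
have := @lobachevsky_dup (pi / 2); rewrite subrr lobachevsky0 lobachevsky_pihalf.
have -> : 2 * (pi / 2) = pi :> R by lra.
by move=> h; have := h ltac:(lra); lra.
Qed.

Let psi0 : psi 0 = 0. Proof. by rewrite /psi subr0 lobachevsky_pihalf. Qed.

Let psi_le (g dg : R -> R) (a b : R) : 0 <= a -> a <= b -> b <= pi / 2 ->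
  (forall x : R, is_derive x 1 g (dg x)) ->
  (forall x, a < x < b -> ln (2 * cos x) <= dg x) ->
  psi b - psi a <= g b - g a.
Proof.
have pp := @pi_gt0 R.
move=> a0 ab bp dG le; have : g a - psi a <= g b - psi b; last lra.
apply: (@derive_ge0_le _ (fun y => g y - psi y) (fun x => dg x - ln (2 * cos x)) a b ab) => [x|x|].
- rewrite in_itv /= => /andP[ax xb]; have h : 0 <= x < pi / 2 by lra.
  exact: deriveB_pt (dG x) (psi_derive h).
- by rewrite in_itv /= => xab; rewrite subr_ge0 le.
- move=> x; apply: cvgB; last exact: psi_continuous.
  by apply: continuous_subspaceT => y; exact: derive_continuous (dG y).
Qed.

Let psi_ge_const (k a b : R) : 0 <= a -> a <= b -> b <= pi / 2 ->
  (forall x, a < x < b -> k <= ln (2 * cos x)) ->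
  k * (b - a) <= psi b - psi a.
Proof.
have pp := @pi_gt0 R.
move=> a0 ab bp le; have : psi a - k * a <= psi b - k * b; last lra.
apply: (@derive_ge0_le _ (fun y => psi y - k * y) (fun x => ln (2 * cos x) - k) a b ab) => [x|x|].
- rewrite in_itv /= => /andP[ax xb].
  have h : 0 <= x < pi / 2 by lra.
  by have := deriveB_pt (psi_derive h) (deriveZ_pt k (derive_id_pt x)); rewrite mulr1.
- by rewrite in_itv /= => xab; rewrite subr_ge0 le.
- move=> x; apply: cvgB; first exact: psi_continuous.
  apply: continuous_subspaceT => y.
  exact: derive_continuous (deriveZ_pt k (derive_id_pt y)).
Qed.

Lemma lobachevsky_compl_le t : 0 <= t <= pi / 2 -> L (pi / 2 - t) <= t * ln 2.
Proof.
have pp := @pi_gt0 R.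
move=> /andP[t0 tp].
have : psi t - psi 0 <= ln 2 * t - ln 2 * 0.
  apply: (@psi_le (fun x => ln 2 * x) (fun=> ln 2) 0 t (lexx _) t0 tp) => x.
    by have := deriveZ_pt (ln 2) (derive_id_pt x); rewrite mulr1.
  move=> x0; have c0 : 0 < cos x by apply: cos_pos; lra.
  by rewrite ler_ln ?posrE ?mulr_gt0 //; have := cos_le1 x; lra.
by rewrite psi0 /psi; lra.
Qed.

(** Integrates ln (2 cos x) <= ln 2 + cos x - 1 over [0, pi / 6]. The constant bound ln 2 would only
    give 3 vol(B_3) <= pi ln 8, above the target pi ln (15 / 2). *)
Lemma lobachevsky_pi3_le : L (pi / 3) <= pi / 6 * (ln 2 - 1) + 1 / 2.
Proof.
have pp := @pi_gt0 R.
have h2 : 0 <= pi / 6 :> R by lra.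
have h3 : pi / 6 <= pi / 2 :> R by lra.
have : psi (pi / 6) - psi 0 <= (ln 2 - 1) * (pi / 6) + sin (pi / 6) - ((ln 2 - 1) * 0 + sin 0).
  pose g (x : R) := (ln 2 - 1) * x + sin x.
  have dg (x : R) : is_derive x 1 g ((ln 2 - 1) * 1 + cos x).
    exact: deriveD_pt (deriveZ_pt (ln 2 - 1) (derive_id_pt x)) (is_derive_sin x).
  apply: (psi_le (lexx _) h2 h3 dg) => x x0.
  have c0 : 0 < cos x by apply: cos_pos; lra.
  rewrite lnM ?posrE // mulr1 -addrA lerD2l.
  have := @le_ln1Dx R (cos x - 1); rewrite addrCA subrr addr0.
  by move=> h; have := h ltac:(lra); lra.
rewrite psi0 /psi sin_pi6 sin0 (_ : pi / 2 - pi / 6 = pi / 3); last lra.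
lra.
Qed.

Let ln_2cos_ge (k x : R) : 0 < k -> 0 <= x < pi / 2 -> sin x ^+ 2 <= 1 - k / 4 ->
  2^-1 * ln k <= ln (2 * cos x).
Proof.
move=> k0 x0 sx; have c0 : 0 < cos x by apply: cos_pos.
have : ln k <= ln ((2 * cos x) ^+ 2).
  rewrite ler_ln ?posrE ?exprn_gt0 ?mulr_gt0 //.
  by have := cos2Dsin2 x; rewrite exprMn; lra.
by rewrite lnXn ?mulr_gt0 // mulr2n; lra.
Qed.

Lemma lobachevsky_pi3_ge : pi / 12 * ln 3 <= L (pi / 3).
Proof.
have pp := @pi_gt0 R.
have h2 : 0 <= pi / 6 :> R by lra.
have h3 : pi / 6 <= pi / 2 :> R by lra.
have : 2^-1 * ln 3 * (pi / 6 - 0) <= psi (pi / 6) - psi 0; last first.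
  by rewrite psi0 /psi (_ : pi / 2 - pi / 6 = pi / 3); lra.
apply: psi_ge_const (lexx _) h2 h3 _ => x x0; apply: ln_2cos_ge; [lra|lra|].
have s1 : sin x <= 1 / 2 by rewrite -sin_pi6; apply: sin_mono; lra.
have s0 : 0 < sin x by apply: sin_gt0_pi; lra.
by rewrite expr2; nra.
Qed.

(** A lower step function for ln (2 cos x): (ln 3) / 2 up to pi / 6, then (ln 2) / 2 up to pi / 4.
    It gives 3 v_oct >= pi ln 18; the single value (ln 2) / 2 would give only pi ln 8, short of pi
    ln 15. *)
Lemma lobachevsky_pi4_ge : pi / 24 * (2 * ln 3 + ln 2) <= L (pi / 4).
Proof.
have pp := @pi_gt0 R.
have h1 : 0 <= pi / 6 :> R by lra.
have h2 : pi / 6 <= pi / 4 :> R by lra.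
have h3 : pi / 4 <= pi / 2 :> R by lra.
have : 2^-1 * ln 2 * (pi / 4 - pi / 6) <= psi (pi / 4) - psi (pi / 6).
  apply: psi_ge_const h1 h2 h3 _ => x x0; apply: ln_2cos_ge; [lra|lra|].
  have s1 : sin x <= sin (pi / 4) by apply: sin_mono; lra.
  have s0 : 0 < sin x by apply: sin_gt0_pi; lra.
  by have := sin_pi4_sqr R; rewrite !expr2; nra.
rewrite /psi (_ : pi / 2 - pi / 6 = pi / 3); last lra.
rewrite (_ : pi / 2 - pi / 4 = pi / 4); last lra.
by have := lobachevsky_pi3_ge; lra.
Qed.

(** L increases from 0 on [0, pi / 6], where 2 sin <= 1; beyond, the complementary angle is below pi
    / 3, where 2 cos >= 1 makes psi increase from 0. *)
Lemma lobachevsky_ge0 x : 0 <= x <= pi / 2 -> 0 <= L x.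
Proof.
have pp := @pi_gt0 R.
move=> /andP[x0 xp]; have [x6|x6] := leP x (pi / 6).
  rewrite -lobachevsky0.
  apply: (@derive_ge0_le _ L (fun t => - ln (2 * sin t)) 0 x x0) => [y|y|].
  - by rewrite in_itv /= => /andP[y0 yx]; apply: lobachevsky_derive; lra.
  - rewrite in_itv /= => /andP[y0 yx]; rewrite oppr_ge0; apply: ln_le0.
    have : sin y <= 1 / 2 by rewrite -sin_pi6; apply: sin_mono; lra.
    lra.
  - apply: continuous_subspaceW lobachevsky_continuous.
    by apply: subset_itvl; rewrite bnd_simp; lra.
have h2 : 0 <= pi / 2 - x by lra.
have h3 : pi / 2 - x <= pi / 2 by lra.
have : 0 * (pi / 2 - x - 0) <= psi (pi / 2 - x) - psi 0; last first.
  by rewrite psi0 /psi mul0r subr0 subKr.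
apply: psi_ge_const (lexx _) h2 h3 _ => y y0.
have c0 : 0 < cos y by apply: cos_pos; lra.
rewrite -[leLHS](mulr0 2^-1) -(ln1 R); apply: ln_2cos_ge; [lra|lra|].
have s1 : sin y <= cos (pi / 6).
  rewrite -sinDpihalf (_ : pi / 6 + pi / 2 = pi - pi / 3); last lra.
  rewrite sinB sinpi cospi mul0r sub0r mulN1r opprK; apply: sin_mono; lra.
have s0 : 0 < sin y by apply: sin_gt0_pi; lra.
by have := cos_pi6_sqr R; rewrite !expr2; nra.
Qed.

End Lobachevsky.

(** * Comparison of the densities *)

Section Volumes.
Variable R : realType.

Lemma vol_bipyramid_ge0 k : 0 <= vol_bipyramid R k.
Proof.
have pp := @pi_gt0 R; rewrite /vol_bipyramid.
have [->|k0] := posnP k; first by rewrite mulr0 mul0r.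
apply: mulr_ge0; first by rewrite mulr_ge0.
have [k2|] := leqP 2 k.
  apply: lobachevsky_ge0; apply/andP; split; first by apply: divr_ge0 => //; exact: ltW.
  by rewrite ler_pM2l // lef_pV2 ?posrE ?ltr0n // ler_nat.
case: k k0 => [|[|]] // _ _; by rewrite divr1 lobachevsky_pi.
Qed.

Lemma vol_bipyramid3_gt0 : 0 < vol_bipyramid R 3.
Proof.
have pp := @pi_gt0 R; rewrite /vol_bipyramid mulr_gt0 ?mulr_gt0 //.
apply: lt_le_trans (lobachevsky_pi3_ge R); rewrite mulr_gt0 ?divr_gt0 //.
by apply: ln_gt0; lra.
Qed.

Lemma vol_bipyramid_double k : vol_bipyramid R (2 * k) <= vol_bipyramid R k + 2 * pi * ln 2.
Proof.
have pp := @pi_gt0 R; have l2 : 0 <= ln 2 :> R by apply: ln_ge0; lra.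
have [->|k0] := posnP k.
  by rewrite /vol_bipyramid muln0 mulr0 !mul0r add0r; apply: mulr_ge0 => //; lra.
have kr : 1 <= k%:R :> R by rewrite ler1n.
have k1 : k%:R != 0 :> R by rewrite pnatr_eq0 -lt0n.
pose t : R := pi / (2 * k)%:R.
have t2 : 2 * t = pi / k%:R by rewrite /t natrM; field.
have kt : k%:R * t = pi / 2 by rewrite /t natrM; field.
have t0 : 0 <= t <= pi / 2.
  have t0 : 0 <= t by apply: divr_ge0 => //; exact: ltW.
  by rewrite t0 /=; nra.
have := lobachevsky_compl_le t0; have := lobachevsky_dup t0.
rewrite /vol_bipyramid -t2 -/t natrM => -> le.
have : k%:R * lobachevsky (pi / 2 - t) <= pi / 2 * ln 2.
  by rewrite -kt -mulrA ler_pM2l ?ltr0n // kt.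
lra.
Qed.

(** The left side is at most 3 pi (ln 2 - 1) + 9. With ln 16 <= ln 15 + 1 / 15 it remains to see 9 <
    pi (3 - 1 / 15), that is pi > 135 / 44, about 3.068. *)
Lemma vol_bipyramid3_lt : 3 * vol_bipyramid R 3 < pi * (ln 15 - ln 2).
Proof.
have pp := @pi_gt0 R; have h := lobachevsky_pi3_le R; have pl := pi_gt307 R.
rewrite /vol_bipyramid.
have e16 : 4 * ln 2 = ln 16 :> R.
  by rewrite (_ : 16 = 2 ^+ 4) ?lnXn //; [rewrite mulr_natl|ring].
have l16 : ln 16 <= ln 15 + 1 / 15 :> R.
  rewrite (_ : 16 = 15 * (1 + 1 / 15)); last by field.
  have p1 : 0 < 1 + 1 / 15 :> R by lra.
  by rewrite lnM ?posrE // lerD2l; apply: le_ln1Dx; lra.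
nra.
Qed.

Lemma vol_oct_gt : pi * ln 15 < 3 * vol_oct R.
Proof.
have pp := @pi_gt0 R; have h := lobachevsky_pi4_ge R.
rewrite /vol_oct /vol_bipyramid.
have e18 : ln 18 = 2 * ln 3 + ln 2 :> R.
  rewrite (_ : 18 = 3 ^+ 2 * 2); last by ring.
  by rewrite lnM ?posrE // lnXn // mulr_natl.
have l18 : ln 15 < ln 18 :> R by rewrite ltr_ln ?posrE //; lra.
have : pi * ln 15 < pi * ln 18 :> R by rewrite ltr_pM2l.
by rewrite e18; lra.
Qed.
End Volumes.

Section Final.
Variables (R : realType) (G : lattice_graph).
Hypotheses (G3 : regular G 3) (Gt : toroidal G) (v0 : vertex G).

(** Forces the entropy of G to be positive, which is how convergence is obtained in
    [entropy_truncation_lim]. *)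
Lemma nu_lozenge_gt0 : 0 < nu_lozenge R G.
Proof.
have V0 : 0 < #|{: vertex G}|%:R :> R by rewrite ltr0n; apply/card_gt0P; exists v0.
rewrite /nu_lozenge divr_gt0 // (vol_lozenge_dual R G3) ltr_wpDl //.
  by apply: sumr_ge0 => f _; exact: vol_bipyramid_ge0.
by rewrite mulr_gt0 // vol_bipyramid3_gt0.
Qed.

(** Both maps being cubic, [nu_bar] is (3 / 2) v_oct for each, so the upper bound needs pi ln 15 < 3
    v_oct. For the lower one, the V / 2 doubled faces cost at most pi ln 2 per vertex, and the
    triangles and the 3 V new vertices account for 4 vol(B_3) per vertex against one before. *)
Lemma bounds_truncation (z : R) :
  nu_lozenge R G <= 2 * pi * z <= nu_bar R G ->
  nu_lozenge R (truncation G) < 2 * pi * ((z + ln 15 / 2) / 3) < nu_bar R (truncation G).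
Proof.
have pp := @pi_gt0 R.
have V0 : 0 < #|{: vertex G}|%:R :> R by rewrite ltr0n; apply/card_gt0P; exists v0.
have cE : #|{: medge G}|%:R = 3 / 2 * #|{: vertex G}|%:R :> R.
  by have := congr1 (fun n => n%:R : R) (cubic_card G3); rewrite !natrM; lra.
have cF : #|faces G|%:R = 1 / 2 * #|{: vertex G}|%:R :> R.
  by have := congr1 (fun n => n%:R : R) Gt; rewrite natrD cE; lra.
rewrite /nu_lozenge /nu_bar (vol_lozenge_dual R G3) (vol_lozenge_dual R (@regular_truncation G)).
rewrite (vol_lozenge_truncation R G3) card_vertex_truncation card_edge_truncation !natrM cE.
have dbl : \sum_(f in faces G) vol_bipyramid R (2 * #|f|) <=
    vol_lozenge R G + #|faces G|%:R * (2 * pi * ln 2).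
  rewrite mulr_natl -sumr_const -big_split /=; apply: ler_sum => f _.
  exact: vol_bipyramid_double.
move: dbl V0; rewrite cF; set V := #|_|%:R; set a' := \sum_(f in _) _; set a := vol_lozenge R G.
have := vol_bipyramid3_lt R; have := vol_oct_gt R.
set v3 := vol_bipyramid R 3; set vo := vol_oct R => hvo hv3 dbl V0 /andP[].
rewrite ler_pdivrMr // ler_pdivlMr // => h1 h2.
have h3 : 2 * pi * z <= 3 / 2 * vo by rewrite -(ler_pM2r V0); lra.
apply/andP; split; last first.
  rewrite ltr_pdivlMr; last lra.
  have : (2 * pi * z + pi * ln 15) * V < (3 / 2 * vo + 3 * vo) * V.
    by rewrite ltr_pM2r //; lra.
  lra.
rewrite ltr_pdivrMr; last lra.
have : 3 * v3 * V < pi * (ln 15 - ln 2) * V by rewrite ltr_pM2r.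
lra.
Qed.
End Final.

(** * Convergence of the entropies *)

Section Asymptotics.
Variable R : realType.

(** The error is of order (log n) / n; bounding the logarithm by a multiple of sqrt n leaves 1 /
    sqrt n, which is enough. *)
Lemma cvg0_of_sqrt_bound (u : R^nat) (C : R) :
  (forall n, (0 < n)%N -> `|u n| * Num.sqrt n%:R <= C) -> u @ \oo --> (0 : R).
Proof.
move=> uC; apply/cvgr0Pnorm_le => e e0; near=> n.
have n0 : (0 < n)%N by near: n; exists 1%N.
have s0 : 0 < Num.sqrt n%:R :> R by rewrite sqrtr_gt0 ltr0n.
rewrite -(ler_pM2r s0); apply: le_trans (uC n n0) _.
rewrite -ler_pdivrMl //; apply: (@le_trans _ _ (Num.sqrt ((e^-1 * C) ^+ 2))).
  by rewrite sqrtr_sqr ler_norm.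
rewrite ler_sqrt ?ler0n //; near: n; exists (Num.truncn ((e^-1 * C) ^+ 2)).+1 => // m /= hm.
apply: le_trans (ltW (truncnS_gt _)) _.
by rewrite ler_nat.
Unshelve. all: by end_near. Qed.

(** B n^2 <= (B sqrt n)^4 and ln y <= y. *)
Lemma ln_sqr_le (B n : nat) : (0 < B)%N -> (0 < n)%N ->
  ln (B * n ^ 2)%:R <= 4 * B%:R * Num.sqrt n%:R :> R.
Proof.
move=> B0 n0; have Br : 1 <= B%:R :> R by rewrite ler1n.
have s0 : 0 < Num.sqrt n%:R :> R by rewrite sqrtr_gt0 ltr0n.
have y0 : 0 < B%:R * Num.sqrt n%:R :> R by rewrite mulr_gt0 ?ltr0n.
apply: (@le_trans _ _ (ln ((B%:R * Num.sqrt n%:R) ^+ 4))).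
  rewrite ler_ln ?posrE ?exprn_gt0 ?ltr0n ?muln_gt0 ?B0 ?expn_gt0 ?n0 //.
  have -> : (B%:R * Num.sqrt n%:R) ^+ 4 = B%:R ^+ 4 * n%:R ^+ 2 :> R.
    by rewrite exprMn -[4%N in X in _ * X]/(2 * 2)%N exprM sqr_sqrtr ?ler0n.
  rewrite natrM natrX.
  rewrite ler_pM2r ?exprn_gt0 ?ltr0n //.
  by rewrite -[leLHS]expr1 ler_weXn2l.
rewrite lnXn // -[leLHS]mulr_natl -[leRHS]mulrA ler_pM2l //.
exact/ltW/ln_sublinear.
Qed.

Lemma ln_mul_exprn (a x y : R) (k m : nat) : 0 < a -> 0 < x -> 0 < y ->
  ln (a * (x ^+ k * y ^+ m)) = ln a + (k%:R * ln x + m%:R * ln y).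
Proof.
move=> a0 x0 y0; rewrite !mulr_natl -!lnXn //.
by rewrite !lnM ?posrE ?mulr_gt0 ?exprn_gt0.
Qed.

Lemma ln_nat_le (a b x k : nat) : (0 < a)%N -> (0 < b)%N -> (0 < x)%N ->
  (a <= b * x ^ k)%N -> ln a%:R <= ln b%:R + k%:R * ln x%:R :> R.
Proof.
move=> a0 b0 x0 le; rewrite mulr_natl -lnXn ?ltr0n // -lnM ?posrE ?exprn_gt0 ?ltr0n //.
by rewrite -natrX -natrM ler_ln ?posrE ?ltr0n ?muln_gt0 ?b0 ?expn_gt0 ?x0 // ler_nat.
Qed.
(** The real arithmetic of one window of side N: a, a' and b are the logarithms of the tree counts
    for c, c' and the lifted domain, x = ln (B N^2), r = sqrt N, E is the number of induced edges,
    and A, V count the edges and vertices of the quotient. *)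
Lemma truncation_error (a a' b l3 l5 x E A V N r B B3 : R) :
  x <= 4 * B * r ->
  a' <= b + B * N * x -> b <= a' + B * N * x ->
  b + ((E + 1) * l3 + V * N ^+ 2 * l5) = a + ((E + 1) * l5 + V * N ^+ 2 * (2 * l3)) ->
  E <= A * N ^+ 2 + B3 * N -> A * N ^+ 2 <= E + B3 * N ->
  3 * V = 2 * A -> B3 <= B -> 0 <= B -> 1 <= V -> 1 <= N -> r * r = N -> 0 <= r ->
  0 <= l5 - l3 <= 1 ->
  `|a' / (3 * V * N ^+ 2) - (a / (V * N ^+ 2) + (l3 + l5) / 2) / 3| * r
    <= 4 * B ^+ 2 + B + 1.
Proof.
move=> hx h1 h2 eq e1 e2 c3 BB B0 V1 N1 rr r0 /andP[d0 d1].
have Vn : V != 0 by rewrite gt_eqF //; lra.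
have Nn : N != 0 by rewrite gt_eqF //; lra.
(* Eliminating a through the exact formula cancels the terms in V N^2 thanks to A = (3 / 2) V,
   leaving the change of domain and the edge count defect. *)
pose num := (a' - b) + (E + 1 - A * N ^+ 2) * (l5 - l3).
have -> : a' / (3 * V * N ^+ 2) - (a / (V * N ^+ 2) + (l3 + l5) / 2) / 3 = num / (3 * V * N ^+ 2).
  have aE : a = b + ((E + 1) * l3 + V * N ^+ 2 * l5) - ((E + 1) * l5 + V * N ^+ 2 * (2 * l3)).
    by rewrite eq; ring.
  have AE : A = 3 / 2 * V by lra.
  by rewrite /num aE AE; field; rewrite Vn Nn.
have r1 : 1 <= r by rewrite leNgt; apply/negP => r1; nra.
have rN : r <= N by rewrite -rr; nra.
have BNx : B * N * x <= B * N * (4 * B * r) by apply: ler_wpM2l => //; rewrite mulr_ge0 //; lra.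
have hnum : `|num| <= B * N * (4 * B * r) + (B * N + 1).
  have BN : B3 * N <= B * N by apply: ler_wpM2r => //; lra.
  have BN0 : 0 <= B * N by rewrite mulr_ge0 //; lra.
  have q1 : (E + 1 - A * N ^+ 2) * (l5 - l3) <= B * N + 1.
    apply: le_trans (ler_wpM2r d0 (_ : _ <= B * N + 1)) _; first lra.
    by rewrite -[leRHS]mulr1 ler_wpM2l //; lra.
  have q2 : - (B * N + 1) <= (E + 1 - A * N ^+ 2) * (l5 - l3).
    apply: le_trans (ler_wpM2r d0 (_ : - (B * N + 1) <= _)); last lra.
    by rewrite mulNr lerN2 -[leRHS]mulr1 ler_wpM2l //; lra.
  by rewrite ler_norml /num; apply/andP; split; lra.
have D0 : 0 < 3 * V * N ^+ 2 by rewrite mulr_gt0 ?exprn_gt0 //; lra.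
rewrite normrM normfV (gtr0_norm D0) mulrAC ler_pdivrMr //.
apply: le_trans (ler_wpM2r r0 hnum) _.
have N2 : 1 <= N ^+ 2 by rewrite exprn_ege1.
have NN : N * N = N ^+ 2 by rewrite expr2.
apply: (@le_trans _ _ ((4 * B ^+ 2 + B + 1) * N ^+ 2)); last first.
  apply: ler_wpM2l; first by rewrite !addr_ge0 // mulr_ge0 // exprn_ge0.
  by rewrite ler_peMl //; lra.
have -> : (B * N * (4 * B * r) + (B * N + 1)) * r = 4 * B ^+ 2 * N ^+ 2 + B * (N * r) + r.
  transitivity (4 * B ^+ 2 * N * (r * r) + B * (N * r) + r); first ring.
  by rewrite rr; ring.
have Nr : N * r <= N ^+ 2 by rewrite -NN ler_wpM2l //; lra.
have rN2 : r <= N ^+ 2 by rewrite -NN; nra.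
have := ler_wpM2l B0 Nr; lra.
Qed.
End Asymptotics.

Section Entropy.
Variables (R : realType) (G : lattice_graph).
Hypotheses (G3 : regular G 3) (v0 : vertex G).
Variables (c : vertex G -> int * int) (c' : vertex (truncation G) -> int * int).
Hypotheses (fc : fundamental_domain c) (fc' : fundamental_domain c').

Let s n : R := ln (nb_spanning_trees (copies c n))%:R / #|` copies c n|%:R.
Let s' n : R := ln (nb_spanning_trees (copies c' n))%:R / #|` copies c' n|%:R.

(** Formulated for the difference of the sequences, so that it is available before either entropy is
    known to converge. *)
Lemma entropy_truncation_cvg0 : (fun n => s' n - (s n + ln 15 / 2) / 3) @ \oo --> (0 : R).
Proof.
pose cl := lift_cell c; have fl : fundamental_domain cl by apply: fundamental_domain_lift.
have [d0 _] := vertex_of_surj v0; pose w0 : vertex (truncation G) := corner d0.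
have [B1 B1P] := compare_copies w0 fl fc'; have [B2 B2P] := compare_copies w0 fc' fl.
have [B3 B3P] := card_induced_copies c.
pose B := (B1 + B2 + B3 + 1)%N.
have powB k n : (0 < n)%N -> (k <= B)%N -> ((k * n ^ 2) ^ (k * n) <= (B * n ^ 2) ^ (B * n))%N.
  move=> n0 kB; apply: (@leq_trans ((B * n ^ 2) ^ (k * n))).
    have [->|k0] := posnP (k * n); first by rewrite !expn0.
    by rewrite leq_exp2r // leq_mul2r kB orbT.
  by rewrite leq_pexp2l ?leq_mul2r ?kB ?orbT // muln_gt0 expn_gt0 n0 /B addn1.
apply: (@cvg0_of_sqrt_bound R _ (4 * B%:R ^+ 2 + B%:R + 1)) => n n0.
have tr := nb_spanning_trees_truncation G3 (in_copies_lift c n) (copies_gt0 c v0 n0).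
have tc : (0 < nb_spanning_trees (copies c n))%N.
  by apply: nb_spanning_trees_gt0; [exact: copies_gt0|exact: fc].
have tc' : (0 < nb_spanning_trees (copies c' n))%N.
  by apply: nb_spanning_trees_gt0; [exact: copies_gt0|exact: fc'].
have tl : (0 < nb_spanning_trees (copies cl n))%N.
  by apply: nb_spanning_trees_gt0; [exact: copies_gt0|exact: fl].
have x0 : (0 < B * n ^ 2)%N by rewrite muln_gt0 expn_gt0 n0 /B addn1.
have h1 := ln_nat_le R tc' tl x0 (leq_trans (B1P n n0) (leq_mul (leqnn _) (powB B1 n n0 _))).
have h2 := ln_nat_le R tl tc' x0 (leq_trans (B2P n n0) (leq_mul (leqnn _) (powB B2 n n0 _))).
have {}h1 := h1 ltac:(rewrite /B; lia); have {}h2 := h2 ltac:(rewrite /B; lia).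
have lB := @ln_sqr_le R B n ltac:(rewrite /B; lia) n0.
have [e1 e2] := B3P n n0.
have c3 := cubic_card G3; have V0 : (0 < #|{: vertex G}|)%N by apply/card_gt0P; exists v0.
have := congr1 (fun m => ln (m%:R : R)) tr.
rewrite /s /s' !card_copies card_vertex_truncation -/cl.
move: tc tc' tl e1 e2 c3 V0 h1 h2 lB.
set tau := nb_spanning_trees (copies c n); set tau' := nb_spanning_trees (copies c' n).
set taul := nb_spanning_trees _; set E := #|` induced_edges _|; set A := #|{: medge G}|.
set V := #|{: vertex G}|; set r := Num.sqrt n%:R => tc tc' tl e1 e2 c3 V0 h1 h2 lB.
rewrite -c3 !natrM !natrX.
rewrite !ln_mul_exprn ?ltr0n // => eq.
have l9 : ln 9 = 2 * ln 3 :> R.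
  by rewrite (_ : 9 = 3 ^+ 2) ?lnXn ?mulr_natl //; ring.
have l15 : ln 15 = ln 3 + ln 5 :> R.
  by rewrite (_ : 15 = 3 * 5) ?lnM ?posrE //; ring.
have l53 : 0 <= (ln 5 - ln 3 : R) <= 1.
  rewrite subr_ge0 ler_ln ?posrE // ler_nat /= -ln_div ?posrE //.
  have -> : 5 / 3 = 1 + 2 / 3 :> R by field.
  by apply: le_trans (le_ln1Dx _) _; lra.
have toR (k m : nat) : (k <= m)%N -> (k%:R : R) <= m%:R by rewrite ler_nat.
have {}e1 := toR _ _ e1; have {}e2 := toR _ _ e2.
have {}c3 : 3 * V%:R = 2 * A%:R :> R by rewrite -!natrM c3.
have BB : B3%:R <= B%:R :> R by apply: toR; rewrite /B; lia.
clearbody B; have V1 : 1 <= V%:R :> R by rewrite ler1n.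
have N1 : 1 <= n%:R :> R by rewrite ler1n.
have rr : r * r = n%:R by rewrite -expr2 sqr_sqrtr ?ler0n.
have r0 : 0 <= r by exact: sqrtr_ge0.
move: h1 h2 eq e1 e2; rewrite -[E.+1]addn1 !(natrD, natrM, natrX) l9 l15.
move: lB; rewrite natrM natrX => lB h1 h2 eq e1 e2.
have B0 : 0 <= B%:R :> R by rewrite ler0n.
rewrite -!expr2; exact: (truncation_error lB h1 h2 eq e1 e2 c3 BB B0 V1 N1 rr r0 l53).
Qed.

Lemma entropy_truncation (l : R) : s @ \oo --> l -> s' @ \oo --> (l + ln 15 / 2) / 3.
Proof.
move=> sl; have : (fun n => (s' n - (s n + ln 15 / 2) / 3) + (s n + ln 15 / 2) / 3) @ \oo
   --> 0 + (l + ln 15 / 2) / 3.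
  apply: cvgD; first exact: entropy_truncation_cvg0.
  by apply: cvgM; [apply: cvgD => //; exact: cvg_cst|exact: cvg_cst].
by rewrite add0r; under eq_fun do rewrite subrK.
Qed.

(* The limit of a divergent sequence is 0 by convention, so the hypothesis
   provides the convergence. *)
Lemma entropy_truncation_lim : 0 < spanning_tree_entropy R c ->
  spanning_tree_entropy R c' = (spanning_tree_entropy R c + ln 15 / 2) / 3.
Proof.
rewrite /spanning_tree_entropy -/s => z0.
have [cs|/dvgP e] := pselect (cvg (s @ \oo)).
  by apply: cvg_lim => //; exact: entropy_truncation.
by move: z0; rewrite e ltxx.
Qed.
End Entropy.

Local Close Scope classical_set_scope.

Theorem theorem13 (R : realType) (G : lattice_graph)
  (c : vertex G -> int * int) (c' : vertex (truncation G) -> int * int) :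
  planar_lattice_graph G ->
  regular G 3 ->
  two_connected (graph_of G) ->
  two_connected (graph_of (dual_map G)) ->
  fundamental_domain c ->
  fundamental_domain c' ->
  nu_lozenge R G <= 2 * pi * spanning_tree_entropy R c <= nu_bar R G ->
  nu_lozenge R (truncation G) < 2 * pi * spanning_tree_entropy R c'
    < nu_bar R (truncation G).
Proof.
move=> [_ Gt _] G3 [[[v0] _] _] _ fc fc' H.
have pp := @pi_gt0 R.
have z0 : 0 < spanning_tree_entropy R c.
  have := nu_lozenge_gt0 R G3 v0; case/andP: H => h _ /lt_le_trans /(_ h).
  by rewrite pmulr_rgt0 // mulr_gt0.
by rewrite (entropy_truncation_lim G3 v0 fc fc' z0); apply: bounds_truncation.
Qed.
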